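(* Let $(M,g)$ be a Kähler manifold satisfying the $\Delta$-property. Then $M$ is a complex space form, i.e. $(M,g)$ has constant holomorphic sectional curvature.
   Context: Let $(M,g)$ be a Kähler manifold of complex dimension $n$. In local holomorphic coordinates $z=(z_1,\dots,z_n)$ the Kähler Laplacian is $$\Delta=\sum_{i,j=1}^n g^{i\bar j}\frac{\partial^2}{\partial z_j\,\partial\bar z_i},$$ where $(g^{i\bar j})$ denotes the inverse matrix of the matrix of the Kähler metric $g$ in the coordinates $z$. The complex Euclidean Laplacian with respect to $z$ is the differential operator $$\Delta_c^z=\sum_{i=1}^n\frac{\partial^2}{\partial z_i\,\partial\bar z_i}.$$ $\Delta$-property: $(M,g)$ satisfies the $\Delta$-property if there exist, for every positive integer $k$, a monic polynomial $p_k$ of degree $k$ in one variable with real coefficients (independent of the point $x$) such that for every point $x\in M$ there exists a holomorphic coordinate system $z$ centered at $x$ (i.e. $x$ corresponds to $z=0$) with the following property: for every smooth function $\phi$ defined in a neighborhood of $x$ and every positive integer $k$, $$\Delta^k\phi(0)=p_k(\Delta_c^z)\phi(0).$$ A complex space form is a Kähler manifold of constant holomorphic sectional curvature. *)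

(* Defs.v *)
From HB Require Import structures.
From mathcomp Require Import all_boot all_order all_algebra.
From mathcomp Require Import all_classical all_reals all_analysis.
From mathcomp Require Import complex.

Set Implicit Arguments.
Unset Strict Implicit.
Unset Printing Implicit Defensive.

Import Order.TTheory GRing.Theory Num.Theory.
Import numFieldNormedType.Exports.

Local Open Scope classical_set_scope.
Local Open Scope ring_scope.
Local Open Scope complex_scope.

(* The norm topology on R[i], as done in numFieldNormedType for abstract fields. *)
#[non_forgetful_inheritance]
HB.instance Definition _ (R : realType) :=
  NormedModule.copy R[i] (R[i] : numFieldType)^o.

Section calculus.
Context {R : realType} {n : nat}.
Notation C := R[i].
Notation V := 'rV[C]_n.
Implicit Types (f : V -> C) (F : V -> R) (U : set V) (u v w z : V).

(* C^n is differentiated as a real vector space: F is restricted to the real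
   line through z in direction v. *)
Definition along F v z : R -> R := fun t => F (z + t%:C *: v).

Definition dirR v F z : R := derive1 (along F v z) 0.

Definition dir v f z : C :=
  (dirR v (fun y => complex.Re (f y)) z) +i* (dirR v (fun y => complex.Im (f y)) z).

Definition dir_ex v f z : Prop :=
  derivable (along (fun y => complex.Re (f y)) v z) 0 1 /\
  derivable (along (fun y => complex.Im (f y)) v z) 0 1.

Fixpoint Ck (k : nat) U f : Prop :=
  (forall z, U z -> {for z, continuous f}) /\
  (if k is k'.+1 then
     forall v, (forall z, U z -> dir_ex v f z) /\ Ck k' U (dir v f)
   else True).

(* Meant for U open; the values of f outside U are irrelevant. *)
Definition smooth_on U f : Prop := forall k, Ck k U f.

Definition e_ (j : 'I_n) : V := delta_mx 0 j.

(* Wirtinger operators: d/dz_j = (d/dx_j - i d/dy_j) / 2 and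
   d/dzbar_j = (d/dx_j + i d/dy_j) / 2 *)
Definition dz (j : 'I_n) f z : C :=
  (dir (e_ j) f z - 'i * dir ('i *: e_ j) f z) / 2%:R.
Definition dzb (j : 'I_n) f z : C :=
  (dir (e_ j) f z + 'i * dir ('i *: e_ j) f z) / 2%:R.

(* Smooth solutions of the Cauchy-Riemann equations. *)
Definition holomorphic_on U (T : V -> V) : Prop :=
  forall i : 'I_n, smooth_on U (fun z => T z 0 i) /\
    forall j z, U z -> dzb j (fun y => T y 0 i) z = 0.

(* jacobian T z a i = d T_a / d z_i *)
Definition jacobian (T : V -> V) z : 'M[C]_n :=
  \matrix_(a, i) dz i (fun y => T y 0 a) z.

Definition lapl_c f : V -> C := fun z => \sum_i dz i (dzb i f) z.

Definition poly_lapl_c (p : {poly R}) f z : C :=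
  \sum_(k < size p) (p`_k)%:C * iter k lapl_c f z.

(* Below, G is a Hermitian metric in coordinates, with
   G z i j = g_{i jbar} = g(d/dz_i, d/dzbar_j), so that
   invmx (G z) i j = g^{i jbar}. *)
Implicit Type G : V -> 'M[C]_n.

Definition hform G z u v : C := \sum_i \sum_j G z i j * u 0 i * (v 0 j)^*.

(* The real 2-form Re (hform (i u) v) = - Im (hform u v), a constant multiple of
   i sum_{i,j} g_{i jbar} dz_i /\ dzbar_j *)
Definition kform G z u v : R := - complex.Im (hform G z u v).

(* Exterior derivative of kform on constant, hence commuting, vector fields. *)
Definition dkform G z u v w : R :=
  dirR u (fun y => kform G y v w) z +
  dirR v (fun y => kform G y w u) z +
  dirR w (fun y => kform G y u v) z.

Definition lapl G f : V -> C :=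
  fun z => \sum_i \sum_j invmx (G z) i j * dz j (dzb i f) z.

(* Curvature tensor of the Levi-Civita (= Chern) connection of a Kaehler metric:
   R_{i jbar k lbar} = - d_k d_lbar g_{i jbar}
     + sum_{p,q} g^{q pbar} (d_k g_{i qbar}) (d_lbar g_{p jbar}) *)
Definition curv G z (i j k l : 'I_n) : C :=
  - dz k (dzb l (fun y => G y i j)) z
  + \sum_p \sum_q invmx (G z) q p *
      dz k (fun y => G y i q) z * dzb l (fun y => G y p j) z.

(* R(v, vbar, v, vbar) / g(v, vbar)^2 for v of type (1,0); the usual
   normalisations of the metric only change this by a constant factor. *)
Definition hol_sec_curv G z v : C :=
  (\sum_i \sum_j \sum_k \sum_l
     curv G z i j k l * v 0 i * (v 0 j)^* * v 0 k * (v 0 l)^*)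
  / hform G z v v ^+ 2.

End calculus.

Section manifolds.
Context {R : realType}.
Notation C := R[i].

(* coord is only meaningful on dom, and point only on coord @` dom. *)
Record chart (M : topologicalType) (n : nat) := Chart {
  dom : set M;
  coord : M -> 'rV[C]_n;
  point : 'rV[C]_n -> M;
  dom_open : open dom;
  img_open : open (coord @` dom);
  coordK : forall x, dom x -> point (coord x) = x;
  coord_continuous : {within dom, continuous coord};
  point_continuous : {within coord @` dom, continuous point} }.

Definition img M n (c : chart M n) : set 'rV[C]_n := coord c @` dom c.

Definition overlap M n (c c' : chart M n) : set 'rV[C]_n :=
  coord c @` (dom c `&` dom c').

Definition transition M n (c c' : chart M n) : 'rV[C]_n -> 'rV[C]_n :=
  fun z => coord c' (point c z).

Definition compatible M n (c c' : chart M n) : Prop :=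
  holomorphic_on (overlap c c') (transition c c') /\
  holomorphic_on (overlap c' c) (transition c' c).

Record complexManifold (n : nat) := ComplexManifold {
  carrier :> topologicalType;
  manifold_hausdorff : hausdorff_space carrier;
  manifold_second_countable : @second_countable carrier;
  atlas : set (chart carrier n);
  atlas_cover : forall x, exists2 c, atlas c & dom c x;
  atlas_compatible : forall c c', atlas c -> atlas c' -> compatible c c';
  atlas_maximal : forall c,
    (forall c', atlas c' -> compatible c c') -> atlas c }.

(* A Kaehler metric is given by its component matrices (g_{i jbar}) in all
   holomorphic charts (values on charts outside the atlas, or outside the image
   of a chart, are irrelevant). *)
Record kahlerMetric n (X : complexManifold n) := KahlerMetric {
  metric : chart X n -> 'rV[C]_n -> 'M[C]_n;
  metric_smooth : forall c, atlas c ->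
    forall i j, smooth_on (img c) (fun z => metric c z i j);
  metric_hermitian : forall c, atlas c -> forall z, img c z ->
    forall i j, metric c z j i = (metric c z i j)^*;
  metric_pos : forall c, atlas c -> forall z, img c z ->
    forall v, v != 0 -> 0 < hform (metric c) z v v;
  metric_transition : forall c c', atlas c -> atlas c' ->
    forall z, overlap c c' z ->
    let J := jacobian (transition c c') z in
    metric c z =
      J^T *m metric c' (transition c c' z) *m map_mx (@conjc R) J;
  metric_closed : forall c, atlas c -> forall z, img c z ->
    forall u v w, dkform (metric c) z u v w = 0 }.

Definition smooth_fun n (X : complexManifold n) (W : set X) (phi : X -> C) :=
  forall y, W y -> exists c : chart X n, [/\ atlas c, dom c y &
    smooth_on (coord c @` (dom c `&` W)) (phi \o point c)].

Definition centered_at n (X : complexManifold n) (c : chart X n) (x : X) :=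
  [/\ atlas c, dom c x & coord c x = 0].

Definition Delta_property n (X : complexManifold n) (g : kahlerMetric X) :=
  exists p : nat -> {poly R},
    (forall k, (0 < k)%N -> p k \is monic /\ size (p k) = k.+1) /\
    forall x : X, exists2 c : chart X n, centered_at c x &
      forall (W : set X) (phi : X -> C),
        open W -> W x -> smooth_fun W phi ->
        forall k, (0 < k)%N ->
          iter k (lapl (metric g c)) (phi \o point c) 0 =
          poly_lapl_c (p k) (phi \o point c) 0.

Definition constant_hol_sec_curv n (X : complexManifold n)
    (g : kahlerMetric X) :=
  exists kappa : R, forall c : chart X n, atlas c -> forall z, img c z ->
    forall v, v != 0 -> hol_sec_curv (metric g c) z v = kappa%:C.

End manifolds.

Arguments chart R M n : clear implicits.
Arguments complexManifold R n : clear implicits.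

(* Main.v *)
Require Import Defs.
From mathcomp Require Import all_boot all_order all_algebra.
From mathcomp Require Import all_classical all_reals all_analysis.
From mathcomp Require Import complex ring lra.

(** Write h for the inverse of the metric, L = sum h^{ij} d_j dbar_i for the
    Kaehler Laplacian and L_c for the Euclidean one, both in a chart c provided
    by the Delta-property at x, so that x is the origin.  For linear forms l, m
    put r(l, m) = sum h^{ij} l_j conj(m_i).  The identity L^k = p_k(L_c) at the
    origin is only tested on products of linear forms and their conjugates; all
    of these vanish at 0, so the constant terms of the p_k never enter.

    - k = 1 on l conj(m) gives h(0) = 1.
    - k = 2 on z_a z_b conj(z_k) says that dbar_b h^{ka} + dbar_a h^{kb} = 0 at
      0.  By the Kaehler condition these two terms are equal, so the first
      derivatives of the metric vanish at 0 (metric_first_order).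
    - k = 2 on |l|^2 gives L q (0) = b Q, where q = r(l, l), Q = q(0) = |l|^2
      and b is the subleading coefficient of p_2.
    - k = 3 on |l|^4: first L |l|^4 = 4 |l|^2 q; applying L twice more and
      using that dh(0) = 0, the value at 0 is 4 (3 Q L q (0) + 2 P) where P is
      the contraction of d_i dbar_j h^{kl} with l, conj(l), l, conj(l).  On the
      Euclidean side only c L_c^2 |l|^4 = 4 c Q^2 survives, c being the
      subleading coefficient of p_3.  Hence P = (c - 3 b) / 2 * Q^2
      (curvature_at_origin).

    Since the first derivatives of the metric vanish, P is the value of the
    curvature tensor on the vector conj(l) and its conjugate, so every
    holomorphic sectional curvature at x is (c - 3 b) / 2.  This number does not
    depend on x, whence it is the same everywhere, even on a disconnected
    manifold.

    The charts where the sectional curvature has to be computed are arbitrary,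
    so the second half of the argument is the invariance of the curvature under
    a holomorphic change of coordinates T (hol_sec_curv_pullback).  Contracting
    with a fixed vector v first, one differentiates
    G(v, v) = sum w_a G'_{ab}(T) conj(w_b), with w = d_v T holomorphic.  Because
    G' is Euclidean to first order at the image point, d_v dbar_v of this is the
    same second derivative of G' contracted with w, plus |d_v w|^2; the latter
    is exactly cancelled by the quadratic term of the curvature.

    The calculus behind this starts from the existence and continuity of all
    iterated directional derivatives: the mean value theorem on real lines
    yields total differentiability (C1_frechet), from it the chain rule and the
    linearity of the derivative in the direction, and the symmetry of second
    derivatives (schwarzR). *)

Set Implicit Arguments.
Unset Strict Implicit.
Unset Printing Implicit Defensive.

Import Order.TTheory GRing.Theory Num.Theory.
Import numFieldNormedType.Exports.

Local Open Scope classical_set_scope.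
Local Open Scope ring_scope.

Local Notation "x %:C" := (real_complex _ x) (format "x %:C") : ring_scope.
Local Notation "x +i* y" := (Complex x y) : ring_scope.
Local Notation Re := complex.Re.
Local Notation Im := complex.Im.

(** * Neighbourhoods in terms of real and imaginary parts *)

Section boxes.
Context {R : realType} {n : nat}.
Notation C := R[i].
Notation V := 'rV[C]_n.

Lemma ReD (x y : C) : Re (x + y) = Re x + Re y. Proof. by case: x y => [a b] []. Qed.
Lemma ImD (x y : C) : Im (x + y) = Im x + Im y. Proof. by case: x y => [a b] []. Qed.
Lemma ReN (x : C) : Re (- x) = - Re x. Proof. by case: x. Qed.
Lemma ImN (x : C) : Im (- x) = - Im x. Proof. by case: x. Qed.
Lemma ReM (x y : C) : Re (x * y) = Re x * Re y - Im x * Im y.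
Proof. by case: x y => [a b] []. Qed.
Lemma ImM (x y : C) : Im (x * y) = Re x * Im y + Im x * Re y.
Proof. by case: x y => [a b] []. Qed.
Lemma ReCr (t : R) : Re t%:C = t. Proof. by []. Qed.
Lemma ImCr (t : R) : Im t%:C = 0. Proof. by []. Qed.
Lemma ReJ (x : C) : Re (x^* ) = Re x. Proof. by case: x. Qed.
Lemma ImJ (x : C) : Im (x^* ) = - Im x. Proof. by case: x. Qed.
Lemma Rei : Re 'i = 0 :> R. Proof. by []. Qed.
Lemma Imi : Im 'i = 1 :> R. Proof. by []. Qed.
Lemma Re0 : Re 0 = 0 :> R. Proof. by []. Qed.
Lemma Im0 : Im 0 = 0 :> R. Proof. by []. Qed.
Lemma Re1 : Re 1 = 1 :> R. Proof. by []. Qed.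
Lemma Im1 : Im 1 = 0 :> R. Proof. by []. Qed.
Lemma Re_mk (a b : R) : Re (a +i* b) = a. Proof. by []. Qed.
Lemma Im_mk (a b : R) : Im (a +i* b) = b. Proof. by []. Qed.
Definition ReImE := ((Re_mk, Im_mk), ReD, ImD, ReN, ImN, ReM, ImM, ReCr, ImCr, ReJ, ImJ, (Rei, Imi), (Re0, Im0), (Re1, Im1)).
Lemma complex_eqP (x y : C) : Re x = Re y -> Im x = Im y -> x = y.
Proof. by case: x y => [a b] [c d] /= -> ->. Qed.

(** A basis of neighbourhoods with real radii; it lets all estimates below be made
    on real numbers. *)
Definition box (z : V) (d : R) : set V := [set y | forall j,
  `|Re (y 0 j - z 0 j)| < d /\ `|Im (y 0 j - z 0 j)| < d].

(** The two halves compare the modulus with the maximum of the real and imaginary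
    parts, which is why the radius is halved in one direction only. *)
Lemma normC_ltP (w : C) (d : R) :
  (`|Re w| < d / 2 -> `|Im w| < d / 2 -> `|w| < d%:C) /\
  (`|w| < d%:C -> `|Re w| < d /\ `|Im w| < d).
Proof.
rewrite normc_def ltcR; split.
  move=> hR hI.
  have d0 : 0 < d by have := normr_ge0 (Re w); lra.
  rewrite -[X in _ < X](ger0_norm (ltW d0)) -sqrtr_sqr ltr_sqrt ?exprn_gt0//.
  rewrite -(real_normK (num_real (Re w))) -(real_normK (num_real (Im w))).
  have := normr_ge0 (Re w); have := normr_ge0 (Im w); nra.
move=> h; have d0 : 0 < d by apply: le_lt_trans h; exact: sqrtr_ge0.
have hs : (Re w)^+2 + (Im w)^+2 < d ^+2.
  by move: h; rewrite -[X in _ < X -> _](ger0_norm (ltW d0)) -sqrtr_sqr ltr_sqrt // exprn_gt0.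
move: (sqr_ge0 (Re w)) (sqr_ge0 (Im w)) => h1 h2.
by split; rewrite -(ltr_pXn2r (n:=2)) ?nnegrE ?(ltW d0)// real_normK ?num_real//; lra.
Qed.

Lemma nbhs_box (z : V) (A : set V) :
  nbhs z A <-> exists2 d, 0 < d & box z d `<=` A.
Proof.
rewrite nbhs_ballP; split.
  case=> e /= e0 h.
  have ee : e = (Re e)%:C by rewrite RRe_real // gtr0_real.
  have e0' : 0 < Re e by rewrite -ltcR -ee.
  exists (Re e / 2); first by lra.
  move=> y by_; apply: h; split=> // i j; rewrite (ord1 i).
  rewrite -ball_normE /= ee distrC.
  by have [p q] := by_ j; apply: (proj1 (normC_ltP _ _)).
case=> d d0 h; exists d%:C; first by rewrite /= ltcR.
move=> y [_ by_]; apply: h => j.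
have := by_ 0 j; rewrite -ball_normE /= distrC.
exact: (proj2 (normC_ltP _ _)).
Qed.

Lemma nbhs_boxC (z : C) (A : set C) :
  nbhs z A <-> exists2 d, 0 < d & forall y, `|Re (y - z)| < d -> `|Im (y - z)| < d -> A y.
Proof.
rewrite nbhs_ballP; split.
  case=> e /= e0 h.
  have ee : e = (Re e)%:C by rewrite RRe_real // gtr0_real.
  have e0' : 0 < Re e by rewrite -ltcR -ee.
  exists (Re e / 2); first by lra.
  move=> y p q; apply: h; rewrite -ball_normE /= ee distrC.
  exact: (proj1 (normC_ltP _ _)).
case=> d d0 h; exists d%:C; first by rewrite /= ltcR.
move=> y; rewrite -ball_normE /= distrC => /(proj2 (normC_ltP _ _)) [].
exact: h.
Qed.

Definition contR (F : V -> R) z := forall e, 0 < e ->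
  exists2 d, 0 < d & forall y, box z d y -> `|F y - F z| < e.

Lemma contRP (f : V -> C) z : {for z, continuous f} <->
  contR (fun y => Re (f y)) z /\ contR (fun y => Im (f y)) z.
Proof.
split.
  move=> cf; split=> e e0.
    have /(cf _)/nbhs_box[d d0 h] : nbhs (f z) [set y | `|Re (y - f z)| < e /\ `|Im (y - f z)| < e].
      by apply/nbhs_boxC; exists e.
    by exists d => // y /h [] /=; rewrite !ReImE.
  have /(cf _)/nbhs_box[d d0 h] : nbhs (f z) [set y | `|Re (y - f z)| < e /\ `|Im (y - f z)| < e].
    by apply/nbhs_boxC; exists e.
  by exists d => // y /h [] /=; rewrite !ReImE.
case=> cR cI A /nbhs_boxC[e e0 h]; apply/nbhs_box.
have [d1 d10 h1] := cR _ e0; have [d2 d20 h2] := cI _ e0.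
exists (Num.min d1 d2); first by rewrite lt_min d10.
move=> y by_; apply: h; rewrite !ReImE.
  by apply: h1 => j; case: (by_ j); rewrite !lt_min => /andP[? _] /andP[].
by apply: h2 => j; case: (by_ j); rewrite !lt_min => /andP[_ ?] /andP[].
Qed.

End boxes.

(** * Restriction to real lines *)

Section lines.
Context {R : realType} {n : nat}.
Notation C := R[i].
Notation V := 'rV[C]_n.
Implicit Types (F : V -> R) (z u v : V).

Lemma along_shift F v z t s : along F v (z + t%:C *: v) s = along F v z (s + t).
Proof. by rewrite /along -addrA -scalerDl addrC [in RHS]addrC rmorphD /= (addrC s%:C). Qed.

Lemma is_derive_along F v z t : derivable (along F v (z + t%:C *: v)) 0 1 ->
  is_derive t (1:R) (along F v z) (dirR v F (z + t%:C *: v)).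
Proof.
move=> dF.
have -> : along F v z = along F v (z + t%:C *: v) \o shift (- t).
  by apply/funext => s; rewrite /= along_shift subrK.
rewrite -[dirR _ _ _]mulr1.
have e0 : shift (- t) t = 0 :> R by rewrite /shift addrN.
have dF' : is_derive (shift (- t) t : R) (1:R) (along F v (z + t%:C *: v)) (dirR v F (z + t%:C *: v)).
  by rewrite e0 /dirR derive1E; exact: derivableP.
exact: (is_derive1_comp dF' (is_derive_shift t 1 (- t))).
Qed.

Lemma MVT_line F v z t :
  (forall s, `|s| <= `|t| -> derivable (along F v (z + s%:C *: v)) 0 1) ->
  exists2 s, `|s| <= `|t| & F (z + t%:C *: v) - F z = t * dirR v F (z + s%:C *: v).
Proof.
move=> dF.
have dF' s : `|s| <= `|t| -> is_derive s (1:R) (along F v z) (dirR v F (z + s%:C *: v)).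
  by move=> st; apply: is_derive_along; exact: dF.
have F0 : F z = along F v z 0 by rewrite /along scale0r addr0.
have FT : F (z + t%:C *: v) = along F v z t by [].
rewrite F0 FT.
have [t0|t0] := leP 0 t.
  have [| |s st e] := @MVT_segment _ (along F v z) (fun s => dirR v F (z + s%:C *: v)) _ _ t0.
  - by move=> x; rewrite in_itv /= => /andP[x0 xt]; apply: dF'; rewrite !ger0_norm// ltW.
  - apply: derivable_within_continuous => x; rewrite in_itv /= => /andP[x0 xt].
    by apply: ex_derive; apply: dF'; rewrite !ger0_norm.
  move: st; rewrite in_itv /= => /andP[s0 st].
  by exists s; rewrite ?ger0_norm// e subr0 mulrC.
have [| |s st e] := @MVT_segment _ (along F v z) (fun s => dirR v F (z + s%:C *: v)) _ _ (ltW t0).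
- by move=> x; rewrite in_itv /= => /andP[x0 xt]; apply: dF'; rewrite !ltr0_norm// lerN2 ltW.
- apply: derivable_within_continuous => x; rewrite in_itv /= => /andP[x0 xt].
  by apply: ex_derive; apply: dF'; rewrite !ler0_norm// ?lerN2// ltW.
move: st; rewrite in_itv /= => /andP[s0 st].
exists s; first by rewrite !ler0_norm ?lerN2// ltW.
by rewrite -[LHS]opprB e; ring.
Qed.

(** Continuity of (a, b) |-> z + a u + b v at the origin: the radius comes from the sum of the sizes of all coordinates of u and v. *)
Lemma box_plane z u v (d : R) : 0 < d -> exists2 s, 0 < s & forall a b, `|a| <= s -> `|b| <= s ->
  box z d (z + a%:C *: u + b%:C *: v).
Proof.
move=> d0.
pose K (w : V) : R := \sum_j (`|Re (w 0 j)| + `|Im (w 0 j)|).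
have K0 (w : V) : 0 <= K w by apply: sumr_ge0 => j _; rewrite addr_ge0.
have Kle (w : V) j : `|Re (w 0 j)| <= K w /\ `|Im (w 0 j)| <= K w.
  rewrite /K (bigD1 j) //=.
  have : 0 <= \sum_(i < n | i != j) (`|Re (w 0 i)| + `|Im (w 0 i)|).
    by apply: sumr_ge0 => i _; rewrite addr_ge0.
  have := normr_ge0 (Re (w 0 j)); have := normr_ge0 (Im (w 0 j)); lra.
have P0 : 0 < 1 + K u + K v by move: (K0 u) (K0 v); lra.
exists (d / 2 / (1 + K u + K v)); first by rewrite divr_gt0// divr_gt0.
set s := _ / _ => a b la lb j.
have s0 : 0 <= s by apply: le_trans la.
have e : s * (1 + K u + K v) = d / 2 by rewrite /s divfK// gt_eqF.
have key (x y : R) : `|x| <= K u -> `|y| <= K v -> `|a * x + b * y| < d.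
  move=> hx hy; apply: le_lt_trans (ler_normD _ _) _; rewrite !normrM.
  have := ler_pM (normr_ge0 a) (normr_ge0 x) la hx.
  have := ler_pM (normr_ge0 b) (normr_ge0 y) lb hy.
  lra.
have [u1 u2] := Kle u j; have [v1 v2] := Kle v j.
rewrite !mxE !ReImE !mul0r !subr0 !addr0; split.
  rewrite (_ : _ - _ = a * Re (u 0 j) + b * Re (v 0 j)); [exact: key|ring].
rewrite (_ : _ - _ = a * Im (u 0 j) + b * Im (v 0 j)); [exact: key|ring].
Qed.

Lemma near_line z v (U : set V) : nbhs z U -> \forall t \near (0:R), U (z + t%:C *: v).
Proof.
move=> /nbhs_box[d d0 dU]; have [s s0 h] := box_plane z v v d0.
apply/nbhs_ballP; exists s => // t; rewrite -ball_normE /= sub0r normrN => ts.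
by apply: dU; have := h t 0 (ltW ts); rewrite normr0 scale0r addr0; apply; exact: ltW.
Qed.

Lemma near_along F G z v : (\forall y \near z, F y = G y) ->
  \forall t \near (0:R), along F v z t = along G v z t.
Proof. by move=> FG; apply: (@near_line z v (fun y => F y = G y)). Qed.

Lemma dirR_near F G z v : (\forall y \near z, F y = G y) -> dirR v F z = dirR v G z.
Proof. by move=> FG; rewrite /dirR !derive1E; apply: near_eq_derive; exact: near_along. Qed.

(** The linear approximation form of the derivative at 0; the chain rule is an
    estimate on this form. *)
Lemma is_deriveP (f : R -> R) (d : R) : is_derive (0:R) (1:R) f d <->
  (forall e, 0 < e -> exists2 s, 0 < s & forall t, `|t| < s -> `|f t - f 0 - t * d| <= e * `|t|).
Proof.
split.
  move=> [df <-] e e0.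
  move: df => /cvg_ex [l]; rewrite /= => hl.
  have -> : 'D_1 f 0 = l by apply/cvg_lim.
  move/cvgrPdist_le : hl => /(_ _ e0) /nbhs_ballP[s /= s0 hs].
  exists s => // t ts; have [->|t0] := eqVneq t 0.
    by rewrite mul0r subr0 subrr normr0 mulr0.
  have := hs t; rewrite -ball_normE /= sub0r normrN => /(_ ts t0).
  rewrite addr0 [_%:A]mulr1 => h.
  have tn : 0 < `|t| by rewrite normr_gt0.
  rewrite (_ : _ - _ = - t * (l - t^-1 *: (f t - f 0))).
    by rewrite normrM normrN mulrC ler_wpM2r// ltW.
  by rewrite /GRing.scale /=; field.
move=> h.
have hl : (fun h => h^-1 *: (f (h *: (1:R) + 0) - f 0)) @ (0:R)^' --> d.
  apply/cvgrPdist_le => e e0; have [s s0 hs] := h e e0.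
  apply/nbhs_ballP; exists s => // t.
  rewrite -ball_normE /= sub0r normrN => ts t0.
  rewrite addr0 [_%:A]mulr1.
  have tn : 0 < `|t| by rewrite normr_gt0.
  rewrite -(ler_pM2r tn) -normrM.
  rewrite (_ : (_ - _) * t = - (f t - f 0 - t * d)); first by rewrite normrN; exact: hs.
  by rewrite /GRing.scale /=; field.
apply: DeriveDef; last by apply/cvg_lim.
by apply/cvg_ex; exists d.
Qed.

End lines.

(** * Total differentiability, chain rule and symmetry of second derivatives *)

Lemma common_radius (R : realType) (I : finType) (P : I -> R -> Prop) :
  (forall i, exists2 d, 0 < d & P i d) ->
  (forall i d d', 0 < d' -> d' <= d -> P i d -> P i d') ->
  exists2 d, 0 < d & forall i, P i d.
Proof.
move=> hP mono.
suff [d d0 h] : exists2 d, 0 < d & forall i, i \in enum I -> P i d.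
  by exists d => // i; apply: h; rewrite mem_enum.
elim: (enum I) => [|i r [d d0 IH]]; first by exists 1.
have [d' d'0 h'] := hP i.
have m0 : 0 < Num.min d d' by rewrite lt_min d0.
exists (Num.min d d') => // k; rewrite inE => /orP[/eqP ->|/IH].
  by apply: mono h' => //; rewrite ge_min lexx orbT.
by apply: mono => //; rewrite ge_min lexx.
Qed.

Section frechet.
Context {R : realType} {n : nat}.
Notation C := R[i].
Notation V := 'rV[C]_n.
Notation B := ('I_n * bool)%type.
Implicit Types (F : V -> R) (z u v w : V).

(** C^n as a real vector space: the index (j, false) stands for the real part of
    the j-th coordinate and (j, true) for its imaginary part. *)
Definition rbasis (b : B) : V := if b.2 then 'i *: e_ b.1 else e_ b.1.
Definition rcoord w (b : B) : R := if b.2 then Im (w 0 b.1) else Re (w 0 b.1).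
Definition of_rcoord (t : B -> R) : V := \row_j (t (j, false) +i* t (j, true)).

Lemma rcoordK w : of_rcoord (rcoord w) = w.
Proof. by apply/rowP => j; rewrite mxE /rcoord /=; case: (w 0 j). Qed.

Lemma of_rcoordD t b s : of_rcoord t + s%:C *: rbasis b = of_rcoord (fun b' => t b' + (b' == b)%:R * s).
Proof.
apply/rowP => j; rewrite !mxE; case: b => k b; rewrite !xpair_eqE /rbasis.
apply: complex_eqP; case: b; rewrite !mxE eqxx /= ?andbT ?andbF; case: (j == k);
  rewrite !ReImE ?mulr1n ?mulr0n ?ReImE; ring.
Qed.

Lemma box_of_rcoord z t d : (forall b, `|t b| < d) -> box z d (z + of_rcoord t).
Proof. by move=> h j; rewrite !mxE addrAC subrr add0r; split; apply: h. Qed.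

(** Move from z to z + t one real coordinate at a time and apply the mean value
    theorem to each step: every partial derivative is evaluated inside a box where
    it is e-close to its value at z. *)
Lemma C1_frechet F z (U : set V) : nbhs z U ->
  (forall y, U y -> forall b, derivable (along F (rbasis b) y) 0 1) ->
  (forall b, contR (dirR (rbasis b) F) z) ->
  forall e : R, 0 < e -> exists2 d : R, 0 < d & forall t, (forall b, `|t b| < d) ->
    `|F (z + of_rcoord t) - F z - \sum_b t b * dirR (rbasis b) F z| <= e * \sum_b `|t b|.
Proof.
move=> /nbhs_box[d0 d00 dU] dF cF e e0.
have [d1 d10 h1] : exists2 d : R, 0 < d & forall b y, box z d y ->
    `|dirR (rbasis b) F y - dirR (rbasis b) F z| < e.
  apply: common_radius => [b|b d d' d'0 dd' h y by_]; first exact: cF.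
  by apply: h => j; case: (by_ j) => p q; split; apply: lt_le_trans dd'.
exists (Num.min d0 d1); first by rewrite lt_min d00.
move=> t td.
(* The intermediate point where only the coordinates listed in r have moved. *)
pose mask (r : seq B) b := if b \in r then t b else 0.
suff main r : uniq r -> `|F (z + of_rcoord (mask r)) - F z -
    \sum_(b <- r) t b * dirR (rbasis b) F z| <= e * \sum_(b <- r) `|t b|.
  have := main (index_enum B) (index_enum_uniq _).
  by rewrite (_ : mask _ = t) //; apply/funext => b; rewrite /mask mem_index_enum.
elim: r => [_|b r IH /= /andP[br ur]].
  rewrite !big_nil mulr0 subr0 (_ : of_rcoord _ = 0) ?addr0 ?subrr ?normr0 //.
  by apply/rowP => j; rewrite !mxE.
have step s : `|s| <= `|t b| -> forall d, d0 <= d \/ d1 <= d -> 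
    box z d (z + of_rcoord (mask r) + s%:C *: rbasis b).
  move=> st d hd; rewrite -addrA of_rcoordD; apply: box_of_rcoord => b'.
  have lt_d (x : R) : `|x| < Num.min d0 d1 -> `|x| < d.
    rewrite lt_min => /andP[x0 x1].
    by case: hd => hd; apply: lt_le_trans hd.
  apply: lt_d; have [->|bb'] := eqVneq b' b.
    by rewrite /mask (negbTE br) mul1r add0r; exact: le_lt_trans st (td b).
  rewrite mul0r addr0 /mask; case: ifP => // _.
  by rewrite normr0; apply: le_lt_trans (td b); exact: normr_ge0.
have em : z + of_rcoord (mask (b :: r)) = z + of_rcoord (mask r) + (t b)%:C *: rbasis b.
  rewrite -addrA of_rcoordD; congr (_ + of_rcoord _); apply/funext => b'.
  rewrite /mask inE; have [->|bb'] := eqVneq b' b; last by rewrite mul0r addr0.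
  by rewrite (negbTE br) add0r mul1r.
have [s st eF] := @MVT_line _ _ F (rbasis b) (z + of_rcoord (mask r)) (t b)
  (fun s st => dF _ (dU _ (step s st d0 (or_introl (lexx _)))) b).
have hs := h1 b _ (step s st d1 (or_intror (lexx _))).
rewrite !big_cons em.
have {}IH := IH ur; set S := \sum_(_ <- _) _ in IH *; set N := \sum_(_ <- _) _ in IH *.
rewrite (_ : _ - _ = (F (z + of_rcoord (mask r)) - F z - S) +
   t b * (dirR (rbasis b) F (z + of_rcoord (mask r) + s%:C *: rbasis b) - dirR (rbasis b) F z)).
  apply: le_trans (ler_normD _ _) _; rewrite [leRHS]mulrDr [leRHS]addrC; apply: lerD => //.
  by rewrite normrM mulrC ler_wpM2r// ltW.
rewrite mulrBr -eF; ring.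
Qed.

(** Insert the increments x_b of the coordinates of g into the linear
    approximation of F; the error splits into the one of F, bounded by a multiple of
    the sum of |x_b|, and the one of g. *)
Lemma chain_rule_rbasis F (g : R -> V) w (U : set V) : nbhs (g 0) U ->
  (forall y, U y -> forall b, derivable (along F (rbasis b) y) 0 1) ->
  (forall b, contR (dirR (rbasis b) F) (g 0)) ->
  (forall b, is_derive (0:R) (1:R) (fun t => rcoord (g t) b) (rcoord w b)) ->
  is_derive (0:R) (1:R) (fun t => F (g t)) (\sum_b rcoord w b * dirR (rbasis b) F (g 0)).
Proof.
move=> gU dF cF dg; apply/is_deriveP => e e0.
set D := fun b => dirR (rbasis b) F (g 0).
(* W bounds the increments of g, as |x_b| <= (1 + |w_b|) |t| for small t;
   DD bounds the partial derivatives of F. The error e is divided equally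
   between F and g. *)
pose W : R := 1 + \sum_b (1 + `|rcoord w b|).
pose DD : R := 1 + \sum_b `|D b|.
have W0 : 0 < W by rewrite ltr_wpDr// sumr_ge0// => b _; rewrite addr_ge0.
have D0 : 0 < DD by rewrite ltr_wpDr// sumr_ge0.
have Wb b : 1 + `|rcoord w b| <= W.
  rewrite /W (bigD1 b) //= addrCA lerDl addr_ge0// sumr_ge0// => i _; by rewrite addr_ge0.
have [d d0 hF] := C1_frechet gU dF cF (divr_gt0 (divr_gt0 e0 (ltr0n _ 2)) W0).
pose eta := Num.min 1 (e / 2 / DD).
have eta0 : 0 < eta by rewrite lt_min ltr01 /= divr_gt0// divr_gt0.
have [s s0 hs] : exists2 s : R, 0 < s & forall b t, `|t| < s ->
    `|rcoord (g t) b - rcoord (g 0) b - t * rcoord w b| <= eta * `|t|.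
  apply: common_radius => [b|b x y y0 yx h t ty].
    by have /is_deriveP := dg b; exact.
  by apply: h; exact: lt_le_trans yx.
exists (Num.min s (d / W)); first by rewrite lt_min s0 divr_gt0.
move=> t; rewrite lt_min => /andP[ts]; rewrite ltr_pdivlMr// => td.
pose x b := rcoord (g t) b - rcoord (g 0) b.
have xw b : `|x b - t * rcoord w b| <= eta * `|t| by exact: hs.
have xle b : `|x b| <= (1 + `|rcoord w b|) * `|t|.
  rewrite -[x b](subrK (t * rcoord w b)); apply: le_trans (ler_normD _ _) _.
  rewrite mulrDl normrM [`|t| * _]mulrC lerD2r; apply: le_trans (xw b) _.
  by rewrite ler_wpM2r// ge_min lexx.
have gt : g t = g 0 + of_rcoord x.
  rewrite -[g t]rcoordK -[g 0]rcoordK; apply/rowP => j; rewrite !mxE.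
  by apply: complex_eqP; rewrite !ReImE /x addrC subrK.
have {}hF := hF x _.
rewrite gt mulr_sumr.
rewrite (_ : _ - _ = (F (g 0 + of_rcoord x) - F (g 0) - \sum_b x b * D b) +
  \sum_b (x b - t * rcoord w b) * D b); last first.
  have -> : \sum_b (x b - t * rcoord w b) * D b =
      \sum_b x b * D b - \sum_b t * (rcoord w b * D b).
    by rewrite -sumrB; apply: eq_bigr => b _; ring.
  by rewrite /D; ring.
apply: le_trans (ler_normD _ _) _.
rewrite [e in e * _](_ : e = e / 2 + e / 2); last by field.
rewrite mulrDl; apply: lerD.
  apply: le_trans (hF _) _ => [b|].
    apply: le_lt_trans (xle b) _; rewrite mulrC; apply: le_lt_trans td.
    exact: ler_wpM2l.
  rewrite mulrAC ler_pdivrMr// -[leRHS]mulrA; apply: ler_wpM2l.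
    by apply: ltW; exact: divr_gt0.
  rewrite [leRHS]mulrC.
  apply: (@le_trans _ _ ((\sum_b (1 + `|rcoord w b|)) * `|t|)); last first.
    by apply: ler_wpM2r => //; rewrite /W lerDr.
  by rewrite mulr_suml; apply: ler_sum => b _; exact: xle.
apply: le_trans (ler_norm_sum _ _ _) _.
apply: (@le_trans _ _ (\sum_b eta * `|t| * `|D b|)).
  by apply: ler_sum => b _; rewrite normrM ler_wpM2r.
rewrite -mulr_sumr mulrAC ler_wpM2r//.
apply: (@le_trans _ _ (e / 2 / DD * DD)); last by rewrite divfK// gt_eqF.
apply: ler_pM; [exact: ltW|exact: sumr_ge0|by rewrite ge_min lexx orbT|by rewrite /DD lerDr].
Qed.

Lemma is_derive_coord_line z w b :
  is_derive (0:R) (1:R) (fun t => rcoord (z + t%:C *: w) b) (rcoord w b).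
Proof.
apply/is_deriveP => e e0; exists 1 => // t _.
rewrite (_ : _ - _ = 0); first by rewrite normr0 mulr_ge0// ltW.
by rewrite /rcoord !mxE; case: b.2; rewrite !ReImE !(mul0r, subr0, addr0) -addrA -opprD subrr.
Qed.

(** The chain rule along the line t |-> z + t w. *)
Lemma dirR_linear F z w (U : set V) : nbhs z U ->
  (forall y, U y -> forall b, derivable (along F (rbasis b) y) 0 1) ->
  (forall b, contR (dirR (rbasis b) F) z) ->
  dirR w F z = \sum_b rcoord w b * dirR (rbasis b) F z.
Proof.
move=> zU dF cF; have z0 : z = z + (0:R)%:C *: w by rewrite scale0r addr0.
have := @chain_rule_rbasis F (fun t => z + t%:C *: w) w U.
rewrite -z0 => /(_ zU dF cF (is_derive_coord_line z w)) h.
by rewrite /dirR derive1E; exact: derive_val.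
Qed.

Lemma chain_curve F (g : R -> V) w (U : set V) : nbhs (g 0) U ->
  (forall y, U y -> forall b, derivable (along F (rbasis b) y) 0 1) ->
  (forall b, contR (dirR (rbasis b) F) (g 0)) ->
  (forall b, is_derive (0:R) (1:R) (fun t => rcoord (g t) b) (rcoord w b)) ->
  is_derive (0:R) (1:R) (fun t => F (g t)) (dirR w F (g 0)).
Proof.
move=> gU dF cF dg; rewrite (dirR_linear w gU dF cF); exact: (chain_rule_rbasis gU dF cF dg).
Qed.

(** Two applications of the mean value theorem, first in the direction u to the
    difference F (y + s v) - F y, then in the direction v to the derivative of F
    along u. *)
Lemma second_difference F z u v s (U : set V) :
  (forall a b, `|a| <= `|s| -> `|b| <= `|s| -> U (z + a%:C *: u + b%:C *: v)) ->
  (forall y, U y -> derivable (along F u y) 0 1) ->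
  (forall y, U y -> derivable (along (dirR u F) v y) 0 1) ->
  exists a b, [/\ `|a| <= `|s|, `|b| <= `|s| &
    F (z + s%:C *: u + s%:C *: v) - F (z + s%:C *: v) - (F (z + s%:C *: u) - F z)
    = s * (s * dirR v (dirR u F) (z + a%:C *: u + b%:C *: v))].
Proof.
move=> hU dF ddF.
pose G y := F (y + s%:C *: v) - F y.
have along_tr y : along G u y = along F u (y + s%:C *: v) - along F u y.
  by apply/funext => t; rewrite /along /G /= addrAC.
have Uv a : `|a| <= `|s| -> U (z + a%:C *: u + s%:C *: v) by move=> ha; exact: hU.
have U0 a : `|a| <= `|s| -> U (z + a%:C *: u).
  by move=> ha; have := hU a 0 ha; rewrite normr0 scale0r addr0; apply.
have dG a : `|a| <= `|s| -> derivable (along G u (z + a%:C *: u)) 0 1.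
  by move=> ha; rewrite along_tr; apply: derivableB; apply: dF; [exact: Uv|exact: U0].
have [a ha eG] := MVT_line dG.
have [b hb eD] := @MVT_line _ _ (dirR u F) v (z + a%:C *: u) s
  (fun b hb => ddF _ (hU a b ha hb)).
exists a, b; split => //.
rewrite -eD.
have <- : dirR u G (z + a%:C *: u) = dirR u F (z + a%:C *: u + s%:C *: v) - dirR u F (z + a%:C *: u).
  rewrite /dirR !derive1E along_tr deriveB//; apply: dF; [exact: Uv|exact: U0].
by rewrite -eG /G; ring.
Qed.

(** The second difference over a small parallelogram is symmetric in u and v, and
    after division by s^2 it is a value of each of the mixed derivatives near z. *)
Lemma schwarzR F z u v (U : set V) : nbhs z U ->
  (forall y, U y -> derivable (along F u y) 0 1) ->
  (forall y, U y -> derivable (along F v y) 0 1) ->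
  (forall y, U y -> derivable (along (dirR u F) v y) 0 1) ->
  (forall y, U y -> derivable (along (dirR v F) u y) 0 1) ->
  contR (dirR v (dirR u F)) z -> contR (dirR u (dirR v F)) z ->
  dirR v (dirR u F) z = dirR u (dirR v F) z.
Proof.
move=> /nbhs_box[d d0 dU] du dv duv dvu cuv cvu.
apply/eqP; rewrite -subr_eq0 -normr_le0; apply/ler_addgt0Pl => e e0.
have [d1 d10 h1] := cuv (e / 2) (divr_gt0 e0 (ltr0n _ 2)).
have [d2 d20 h2] := cvu (e / 2) (divr_gt0 e0 (ltr0n _ 2)).
have m0 : 0 < Num.min d (Num.min d1 d2) by rewrite !lt_min d0 d10.
have [s s0 hs] := box_plane z u v m0.
have sub d' : Num.min d (Num.min d1 d2) <= d' -> forall a b, `|a| <= `|s| -> `|b| <= `|s| ->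
    box z d' (z + a%:C *: u + b%:C *: v).
  move=> hd a b; rewrite (gtr0_norm s0) => ha hb j.
  by have [p q] := hs a b ha hb j; split; apply: lt_le_trans hd.
have md : Num.min d (Num.min d1 d2) <= d by rewrite ge_min lexx.
have m1 : Num.min d (Num.min d1 d2) <= d1 by rewrite !ge_min lexx orbT.
have m2 : Num.min d (Num.min d1 d2) <= d2 by rewrite !ge_min lexx !orbT.
have [a [b [ha hb eab]]] := @second_difference F z u v s U
  (fun a b ha hb => dU _ (sub d md a b ha hb)) du duv.
have [a' [b' [ha' hb' eab']]] := @second_difference F z v u s U
  (fun b a hb ha => dU _ (eq_ind_r _ (sub d md a b ha hb) (addrAC _ _ _))) dv dvu.
have {h1} := h1 _ (sub d1 m1 a b ha hb).
have {h2} := h2 _ (eq_ind_r _ (sub d2 m2 b' a' hb' ha') (addrAC _ _ _)).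
have -> : dirR v (dirR u F) (z + a%:C *: u + b%:C *: v) =
          dirR u (dirR v F) (z + a'%:C *: v + b'%:C *: u).
  apply: (mulfI (lt0r_neq0 s0)); apply: (mulfI (lt0r_neq0 s0)).
  apply: (etrans (esym eab)); apply: (etrans _ eab').
  rewrite [z + _ + _ in RHS]addrAC; set f1 := F _; set f2 := F _; set f3 := F _; set f4 := F _.
  by rewrite !opprB addrACA [- f2 + _]addrC addrACA.
move: (dirR u _ (_ + _)) (dirR v (dirR u F) z) (dirR u (dirR v F) z) => X Y Z l1 l2.
clear -l1 l2; by have := ler_distD X Y Z; rewrite (distrC Y X); lra.
Qed.

End frechet.

(** * Directional derivatives of complex-valued functions *)

Section complex_derivatives.
Context {R : realType} {n : nat}.
Notation C := R[i].
Notation V := 'rV[C]_n.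
Implicit Types (f g : V -> C) (z u v w : V) (U : set V).

(** Existence and value of the derivative in one predicate, so that a single lemma
    per operation yields both. *)
Definition is_dir v f z (d : C) : Prop :=
  is_derive (0:R) (1:R) (along (fun y => Re (f y)) v z) (Re d) /\
  is_derive (0:R) (1:R) (along (fun y => Im (f y)) v z) (Im d).

Lemma along0 (F : V -> R) v z : along F v z 0 = F z.
Proof. by rewrite /along scale0r addr0. Qed.

Lemma is_dir_ex v f z d : is_dir v f z d -> dir_ex v f z.
Proof. by case=> h1 h2; split; apply: ex_derive. Qed.

Lemma is_dir_val v f z d : is_dir v f z d -> dir v f z = d.
Proof.
case=> h1 h2; rewrite /dir /dirR !derive1E.
by rewrite (@derive_val _ _ _ _ _ _ _ h1) (@derive_val _ _ _ _ _ _ _ h2); case: d {h1 h2}.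
Qed.

Lemma dir_exP v f z : dir_ex v f z -> is_dir v f z (dir v f z).
Proof. by case=> h1 h2; split; rewrite /dir /dirR ?derive1E /=; apply: derivableP. Qed.

Lemma is_dir_near v f g z d : (\forall y \near z, f y = g y) -> is_dir v f z d -> is_dir v g z d.
Proof.
move=> fg [h1 h2]; split.
  by apply: near_eq_is_derive h1; apply: near_along; apply: filterS fg => y ->.
by apply: near_eq_is_derive h2; apply: near_along; apply: filterS fg => y ->.
Qed.

Lemma is_dir_cst v (c : C) z : is_dir v (fun _ => c) z 0.
Proof. by split; apply: is_derive_cst. Qed.

Lemma is_dirD v f g z df dg : is_dir v f z df -> is_dir v g z dg ->
  is_dir v (fun y => f y + g y) z (df + dg).
Proof.
move=> [f1 f2] [g1 g2]; split; rewrite !ReImE.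
  rewrite (_ : along _ _ _ = along (fun y => Re (f y)) v z + along (fun y => Re (g y)) v z).
    exact: is_deriveD.
  by apply/funext => t; rewrite /along ReImE.
rewrite (_ : along _ _ _ = along (fun y => Im (f y)) v z + along (fun y => Im (g y)) v z).
  exact: is_deriveD.
by apply/funext => t; rewrite /along ReImE.
Qed.

Lemma is_dirN v f z df : is_dir v f z df -> is_dir v (fun y => - f y) z (- df).
Proof.
move=> [f1 f2]; split; rewrite !ReImE.
  rewrite (_ : along _ _ _ = - along (fun y => Re (f y)) v z).
    exact: is_deriveN.
  by apply/funext => t; rewrite /along ReImE.
rewrite (_ : along _ _ _ = - along (fun y => Im (f y)) v z).
  exact: is_deriveN.
by apply/funext => t; rewrite /along ReImE.
Qed.

Lemma is_dirJ v f z df : is_dir v f z df -> is_dir v (fun y => (f y)^* ) z (df^* ).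
Proof.
move=> [f1 f2]; split; rewrite !ReImE.
  rewrite (_ : along _ _ _ = along (fun y => Re (f y)) v z) //.
  by apply/funext => t; rewrite /along ReImE.
rewrite (_ : along _ _ _ = - along (fun y => Im (f y)) v z).
  exact: is_deriveN.
by apply/funext => t; rewrite /along ReImE.
Qed.

Lemma is_dirM v f g z df dg : is_dir v f z df -> is_dir v g z dg ->
  is_dir v (fun y => f y * g y) z (df * g z + f z * dg).
Proof.
move=> [f1 f2] [g1 g2]; split; rewrite !ReImE.
  rewrite (_ : along _ _ _ = along (fun y => Re (f y)) v z * along (fun y => Re (g y)) v z
     - along (fun y => Im (f y)) v z * along (fun y => Im (g y)) v z).
    apply: is_derive_eq; rewrite !along0 /GRing.scale /=; ring.
  by apply/funext => t; rewrite /along ReImE.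
rewrite (_ : along _ _ _ = along (fun y => Re (f y)) v z * along (fun y => Im (g y)) v z
     + along (fun y => Im (f y)) v z * along (fun y => Re (g y)) v z).
  apply: is_derive_eq; rewrite !along0 /GRing.scale /=; ring.
by apply/funext => t; rewrite /along ReImE.
Qed.

(** Since 1 / f = conj f / |f|^2, only the reciprocal of the positive real function
    |f|^2 has to be differentiated. *)
Lemma is_dirV v f z df : f z != 0 -> is_dir v f z df ->
  is_dir v (fun y => (f y)^-1) z (- df / (f z) ^+ 2).
Proof.
move=> fz0 hf.
have fzJ0 : (f z)^* != 0 by rewrite conjC_eq0.
have hN := is_dirM hf (is_dirJ hf).
pose N y := Re (f y * (f y)^* ).
have NE y : f y * (f y)^* = (N y)%:C.
  by apply: complex_eqP; rewrite /N !ReImE //; ring.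
have NV y : ((N y)^-1)%:C = (f y * (f y)^* )^-1 by rewrite NE fmorphV.
have Nz0 : N z != 0.
  have := mulf_neq0 fz0 fzJ0; rewrite NE; apply: contra => /eqP ->; by rewrite rmorph0.
have hI : is_dir v (fun y => ((N y)^-1)%:C) z ((- (N z) ^- 2 * Re (df * (f z)^* + f z * df^* ))%:C).
  split; last by rewrite (_ : along _ _ _ = cst 0) //; exact: is_derive_cst.
  case: hN => hN _.
  rewrite (_ : along _ _ _ = (fun t => (along N v z t)^-1)) //.
  have N0 : along N v z 0 != 0 by rewrite along0.
  apply: (is_derive_eq (is_deriveV N0 hN)).
  by rewrite along0.
have := is_dirM (is_dirJ hf) hI.
rewrite (_ : (fun y => _) = (fun y => (f y)^-1)); last first.
  apply/funext => y; rewrite NV.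
  have [->|fy0] := eqVneq (f y) 0; first by rewrite mul0r invr0 mulr0.
  by rewrite invfM mulrC divfK// conjC_eq0.
congr (is_dir _ _ _ _).
rewrite NV (_ : (- _ * _)%:C = - (f z * (f z)^* )^-1 ^+ 2 *
   (Re (df * (f z)^* + f z * df^* ))%:C); last first.
  by rewrite -NV -exprVn -rmorphXn -rmorphN -rmorphM.
have -> : (Re (df * (f z)^* + f z * df^* ))%:C = df * (f z)^* + f z * df^*.
  by apply: complex_eqP; rewrite !ReImE; ring.
by move: (f z) (f z)^* (df) (df^* ) fz0 fzJ0 => a b c d a0 b0; field; rewrite a0 b0.
Qed.

Lemma is_dir_coord v z j : is_dir v (fun y => y 0 j) z (v 0 j).
Proof.
by split; [have := @is_derive_coord_line R n z v (j, false)|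
           have := @is_derive_coord_line R n z v (j, true)].
Qed.

(** Derivability along every real direction, without any continuity: this is all
    that sum and product rules for first-order operators ask for. *)
Definition dif f z := forall v, dir_ex v f z.

Lemma difP f z v : dif f z -> is_dir v f z (dir v f z).
Proof. by move=> h; apply: dir_exP. Qed.

Lemma dif_cst c z : dif (fun=> c) z.
Proof. by move=> v; apply: is_dir_ex; exact: is_dir_cst. Qed.
Lemma dif_coord j z : dif (fun y => y 0 j) z.
Proof. by move=> v; apply: is_dir_ex; exact: is_dir_coord. Qed.
Lemma difD f g z : dif f z -> dif g z -> dif (fun y => f y + g y) z.
Proof. by move=> df dg v; apply: is_dir_ex; apply: is_dirD; exact: difP. Qed.
Lemma difJ f z : dif f z -> dif (fun y => (f y)^* ) z.
Proof. by move=> df v; apply: is_dir_ex; apply: is_dirJ; exact: difP. Qed.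
Lemma difM f g z : dif f z -> dif g z -> dif (fun y => f y * g y) z.
Proof. by move=> df dg v; apply: is_dir_ex; apply: is_dirM; exact: difP. Qed.
Lemma dif_sum (I : Type) (r : seq I) (f : I -> V -> C) z :
  (forall i, dif (f i) z) -> dif (fun y => \sum_(i <- r) f i y) z.
Proof.
move=> df; elim: r => [|i r IH].
  by under [X in dif X]funext do rewrite big_nil; exact: dif_cst.
by under [X in dif X]funext do rewrite big_cons; exact: difD.
Qed.

Lemma dir_near v f g z : (\forall y \near z, f y = g y) -> dir v f z = dir v g z.
Proof.
move=> fg; rewrite /dir; congr (_ +i* _); apply: dirR_near; by apply: filterS fg => y ->.
Qed.

Lemma near_open U f g z : open U -> U z -> (forall y, U y -> f y = g y) ->
  \forall y \near z, f y = g y.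
Proof. by move=> oU Uz fg; near=> y; apply: fg; near: y; exact: open_nbhs_nbhs.
Unshelve. all: by end_near. Qed.

Lemma dirR_NIm f z u (k : C) : dif f z ->
  dirR u (fun y => - Im (k * f y)) z = - Im (k * dir u f z).
Proof.
move=> df.
have hv : dir u (fun y => - (k * f y)) z = - (k * dir u f z).
  by rewrite (is_dir_val (is_dirN (is_dirM (is_dir_cst u k z) (difP u df)))) mul0r add0r.
rewrite (_ : (fun y => _) = (fun y => Im (- (k * f y)))); last first.
  by apply/funext => y; rewrite ImN.
by rewrite -ImN -hv.
Qed.

End complex_derivatives.

(** * Smooth functions *)

Section smooth.
Context {R : realType} {n : nat}.
Notation C := R[i].
Notation V := 'rV[C]_n.
Implicit Types (f g : V -> C) (z u v w : V) (U : set V).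

Lemma near_cont f g z : (\forall y \near z, f y = g y) ->
  {for z, continuous f} -> {for z, continuous g}.
Proof.
move=> fg cf A; rewrite -(nbhs_singleton fg) => /cf; rewrite !nbhs_simpl /= => h.
by apply: (filterS2 _ _ fg h) => y /= <-.
Qed.

Lemma Ck_ext k U f g : open U -> (forall y, U y -> f y = g y) -> Ck k U f -> Ck k U g.
Proof.
move=> oU; elim: k f g => [|k IH] f g fg /= [cf df]; (split=> [z Uz|]; 
  first by apply: near_cont (near_open oU Uz fg) (cf z Uz)) => //.
move=> v; have [d1 d2] := df v; split.
  by move=> z Uz; apply: is_dir_ex; apply: is_dir_near (near_open oU Uz fg) (dir_exP (d1 z Uz)).
by apply: IH d2 => y Uy; apply: dir_near; exact: near_open fg.
Qed.

Lemma CkS k U f : Ck k.+1 U f -> Ck k U f.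
Proof.
elim: k f => [|k IH] f [cf df]; split => //.
by move=> v; have [d1 d2] := df v; split => //; exact: IH.
Qed.

Lemma Ck_sub k U U' f : U' `<=` U -> Ck k U f -> Ck k U' f.
Proof.
move=> UU'; elim: k f => [|k IH] f [cf df]; (split; first by move=> z /UU'; exact: cf) => //.
by move=> v; have [d1 d2] := df v; split; [move=> z /UU'; exact: d1|exact: IH].
Qed.

Lemma Ck_cst k U c : open U -> Ck k U (fun=> c).
Proof.
move=> oU; elim: k c => [|k IH] c; (split; first by move=> z _; apply/contRP; split=> e e0; exists 1 => // y _;
  rewrite subrr normr0) => //.
move=> v; split; first by move=> z _; exact: dif_cst.
by apply: Ck_ext (IH 0) => // y _; rewrite (is_dir_val (is_dir_cst _ _ _)).
Qed.

Lemma Ck_coord k U j : open U -> Ck k U (fun y => y 0 j).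
Proof.
move=> oU.
have c0 z : U z -> {for z, continuous (fun y : V => y 0 j)}.
  move=> Uz; apply/contRP; split => e e0; exists e => // y /(_ j);
  by rewrite !ReImE => -[].
case: k => [|k]; split => // v; split; first by move=> z _; exact: dif_coord.
by apply: Ck_ext (Ck_cst _ (v 0 j) oU) => // y _; rewrite (is_dir_val (is_dir_coord _ _ _)).
Qed.

Lemma CkD k U f g : open U -> Ck k U f -> Ck k U g -> Ck k U (fun y => f y + g y).
Proof.
move=> oU; elim: k f g => [|k IH] f g [cf df] [cg dg];
  (split; first by move=> z Uz; exact: (cvgD (cf z Uz) (cg z Uz))) => //.
move=> v; have [f1 f2] := df v; have [g1 g2] := dg v.
have h z : U z -> is_dir v (fun y => f y + g y) z (dir v f z + dir v g z).
  by move=> Uz; apply: is_dirD; apply: dir_exP; auto.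
split; first by move=> z Uz; exact: is_dir_ex (h z Uz).
by apply: Ck_ext (IH _ _ f2 g2) => // y Uy; rewrite (is_dir_val (h y Uy)).
Qed.

Lemma CkJ k U f : open U -> Ck k U f -> Ck k U (fun y => (f y)^* ).
Proof.
move=> oU; elim: k f => [|k IH] f [cf df]; (split; first (move=> z Uz;
    have /contRP[c1 c2] := cf z Uz; apply/contRP; split => e e0;
    [have [d d0 h] := c1 e e0|have [d d0 h] := c2 e e0]; exists d => // y /h;
    rewrite !ReImE //; by rewrite -opprD normrN)) => //.
move=> v; have [f1 f2] := df v.
have h z : U z -> is_dir v (fun y => (f y)^* ) z ((dir v f z)^* ).
  by move=> Uz; apply: is_dirJ; apply: dir_exP; auto.
split; first by move=> z Uz; exact: is_dir_ex (h z Uz).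
by apply: Ck_ext (IH _ f2) => // y Uy; rewrite (is_dir_val (h y Uy)).
Qed.

Lemma CkM k U f g : open U -> Ck k U f -> Ck k U g -> Ck k U (fun y => f y * g y).
Proof.
move=> oU; elim: k f g => [|k IH] f g hf hg; case: (hf) (hg) => [cf df] [cg dg];
  (split; first by move=> z Uz; exact: (cvgM (cf z Uz) (cg z Uz))) => //.
move=> v; have [f1 f2] := df v; have [g1 g2] := dg v.
have h z : U z -> is_dir v (fun y => f y * g y) z (dir v f z * g z + f z * dir v g z).
  by move=> Uz; apply: is_dirM; apply: dir_exP; auto.
split; first by move=> z Uz; exact: is_dir_ex (h z Uz).
apply: Ck_ext (CkD oU (IH _ _ f2 (CkS hg)) (IH _ _ (CkS hf) g2)) => // y Uy.
by rewrite (is_dir_val (h y Uy)).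
Qed.

Lemma CkV k U f : open U -> (forall z, U z -> f z != 0) -> Ck k U f ->
  Ck k U (fun y => (f y)^-1).
Proof.
move=> oU f0; elim: k => [|k IH] hf; case: (hf) => [cf df];
  (split; first by move=> z Uz; exact: (cvgV (f0 z Uz) (cf z Uz))) => //.
move=> v; have [f1 f2] := df v.
have h z : U z -> is_dir v (fun y => (f y)^-1) z (- dir v f z / f z ^+ 2).
  by move=> Uz; apply: is_dirV; [exact: f0|apply: dir_exP; auto].
split; first by move=> z Uz; exact: is_dir_ex (h z Uz).
have hV := IH (CkS hf).
apply: Ck_ext (CkM oU (CkM oU (Ck_cst k (-1) oU) f2) (CkM oU hV hV)) => // y Uy.
by rewrite (is_dir_val (h y Uy)) mulN1r expr2 invfM.
Qed.

Lemma smooth_ext U f g : open U -> (forall y, U y -> f y = g y) -> smooth_on U f -> smooth_on U g.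
Proof. by move=> oU fg hf k; exact: Ck_ext (hf k). Qed.
Lemma smooth_sub U U' f : U' `<=` U -> smooth_on U f -> smooth_on U' f.
Proof. by move=> UU' hf k; exact: Ck_sub (hf k). Qed.
Lemma smooth_cst U c : open U -> smooth_on U (fun=> c).
Proof. by move=> oU k; exact: Ck_cst. Qed.
Lemma smooth_coord U j : open U -> smooth_on U (fun y => y 0 j).
Proof. by move=> oU k; exact: Ck_coord. Qed.
Lemma smoothD U f g : open U -> smooth_on U f -> smooth_on U g -> smooth_on U (fun y => f y + g y).
Proof. by move=> oU hf hg k; exact: CkD. Qed.
Lemma smoothM U f g : open U -> smooth_on U f -> smooth_on U g -> smooth_on U (fun y => f y * g y).
Proof. by move=> oU hf hg k; exact: CkM. Qed.
Lemma smoothJ U f : open U -> smooth_on U f -> smooth_on U (fun y => (f y)^* ).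
Proof. by move=> oU hf k; exact: CkJ. Qed.
Lemma smoothV U f : open U -> (forall z, U z -> f z != 0) -> smooth_on U f ->
  smooth_on U (fun y => (f y)^-1).
Proof. by move=> oU f0 hf k; exact: CkV. Qed.
Lemma smooth_sum U (I : Type) (r : seq I) (f : I -> V -> C) : open U ->
  (forall i, smooth_on U (f i)) -> smooth_on U (fun y => \sum_(i <- r) f i y).
Proof.
move=> oU hf; elim: r => [|i r IH].
  by apply: smooth_ext (smooth_cst 0 oU) => // y _; rewrite big_nil.
by apply: smooth_ext (smoothD oU (hf i) IH) => // y _; rewrite big_cons.
Qed.
Lemma smooth_prod U (I : Type) (r : seq I) (f : I -> V -> C) : open U ->
  (forall i, smooth_on U (f i)) -> smooth_on U (fun y => \prod_(i <- r) f i y).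
Proof.
move=> oU hf; elim: r => [|i r IH].
  by apply: smooth_ext (smooth_cst 1 oU) => // y _; rewrite big_nil.
by apply: smooth_ext (smoothM oU (hf i) IH) => // y _; rewrite big_cons.
Qed.
Lemma smooth_dir U f v : smooth_on U f -> smooth_on U (dir v f).
Proof. by move=> hf k; have [_ /(_ v)[]] := hf k.+1. Qed.
Lemma smooth_dif U f z : smooth_on U f -> U z -> dif f z.
Proof. by move=> hf Uz v; have [_ /(_ v)[h _]] := hf 1; exact: h. Qed.

Lemma smooth_det U m (A : V -> 'M[C]_m) : open U ->
  (forall i j, smooth_on U (fun y => A y i j)) -> smooth_on U (fun y => \det (A y)).
Proof.
move=> oU hA; apply: smooth_sum => // s; apply: smoothM => //; first exact: smooth_cst.
by apply: smooth_prod => // i; exact: hA.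
Qed.

(** By Cramer's rule. *)
Lemma smooth_invmx U m (A : V -> 'M[C]_m) : open U ->
  (forall i j, smooth_on U (fun y => A y i j)) -> (forall y, U y -> A y \in unitmx) ->
  forall i j, smooth_on U (fun y => invmx (A y) i j).
Proof.
move=> oU hA uA i j.
apply: (@smooth_ext _ (fun y => (\det (A y))^-1 * ((-1) ^+ (j + i) * \det (row' j (col' i (A y)))))) => //.
  by move=> y Uy; rewrite /invmx (uA y Uy) !mxE.
apply: smoothM => //.
  by apply: smoothV => //; exact: smooth_det.
apply: smoothM => //; first exact: smooth_cst.
apply: smooth_det => // a b.
by apply: smooth_ext (hA (lift j a) (lift i b)) => // y _; rewrite !mxE.
Qed.

Lemma smooth_cont U f z : smooth_on U f -> U z -> {for z, continuous f}.
Proof. by move=> hf; have [h _] := hf 0; exact: h. Qed.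

Lemma schwarz U f z u v : open U -> smooth_on U f -> U z ->
  dir u (dir v f) z = dir v (dir u f) z.
Proof.
move=> oU hf Uz; have nU : nbhs z U by exact: open_nbhs_nbhs.
have /contRP[a1 a2] := smooth_cont (smooth_dir u (smooth_dir v hf)) Uz.
have /contRP[b1 b2] := smooth_cont (smooth_dir v (smooth_dir u hf)) Uz.
have d1 w y (Uy : U y) : dir_ex w f y := smooth_dif hf Uy w.
have d2 w w' y (Uy : U y) : dir_ex w' (dir w f) y := smooth_dif (smooth_dir w hf) Uy w'.
apply: complex_eqP.
  change (dirR u (dirR v (fun y => Re (f y))) z = dirR v (dirR u (fun y => Re (f y))) z).
  exact: (schwarzR nU (fun y Uy => proj1 (d1 v y Uy)) (fun y Uy => proj1 (d1 u y Uy))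
    (fun y Uy => proj1 (d2 v u y Uy)) (fun y Uy => proj1 (d2 u v y Uy)) a1 b1).
change (dirR u (dirR v (fun y => Im (f y))) z = dirR v (dirR u (fun y => Im (f y))) z).
exact: (schwarzR nU (fun y Uy => proj2 (d1 v y Uy)) (fun y Uy => proj2 (d1 u y Uy))
  (fun y Uy => proj2 (d2 v u y Uy)) (fun y Uy => proj2 (d2 u v y Uy)) a2 b2).
Qed.

Lemma chain_rule U f (T : V -> V) z v : open U -> smooth_on U f -> U (T z) ->
  (forall j, dif (fun y => T y 0 j) z) ->
  is_dir v (fun y => f (T y)) z (dir (\row_j dir v (fun y => T y 0 j) z) f (T z)).
Proof.
move=> oU hf UT dT.
have z0 : z + (0:R)%:C *: v = z by rewrite scale0r addr0.
have nU : nbhs (T (z + (0:R)%:C *: v)) U by rewrite z0; exact: open_nbhs_nbhs.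
have cf b : {for T z, continuous (dir (rbasis b) f)} by apply: smooth_cont (smooth_dir _ hf) UT.
have dTb b : is_derive (0:R) (1:R) (fun t => rcoord (T (z + t%:C *: v)) b)
    (rcoord (\row_j dir v (fun y => T y 0 j) z) b).
  by have [h1 h2] := difP v (dT b.1); rewrite /rcoord mxE; case: b.2.
have dfU y : U y -> dif f y by exact: smooth_dif.
split.
  have := @chain_curve _ _ (fun y => Re (f y)) (fun t => T (z + t%:C *: v)) _ U nU _ _ dTb.
  rewrite z0; apply => [y Uy b|b]; first by case: (dfU y Uy (rbasis b)).
  by have /contRP[] := cf b.
have := @chain_curve _ _ (fun y => Im (f y)) (fun t => T (z + t%:C *: v)) _ U nU _ _ dTb.
rewrite z0; apply => [y Uy b|b]; first by case: (dfU y Uy (rbasis b)).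
by have /contRP[] := cf b.
Qed.

Lemma dir_linear U f z w : open U -> smooth_on U f -> U z ->
  dir w f z = \sum_j ((Re (w 0 j))%:C * dir (e_ j) f z + (Im (w 0 j))%:C * dir ('i *: e_ j) f z).
Proof.
move=> oU hf Uz; have nU : nbhs z U by exact: open_nbhs_nbhs.
have cf b : {for z, continuous (dir (rbasis b) f)} by apply: smooth_cont (smooth_dir _ hf) Uz.
have dfU y : U y -> dif f y by exact: smooth_dif.
have bool_sum (F : 'I_n * bool -> R) : \sum_b F b = \sum_j (F (j, false) + F (j, true)).
  rewrite (eq_bigr (fun p => F (p.1, p.2))) => [|[]//].
  rewrite -(pair_big xpredT xpredT (fun j b => F (j, b))) /=.
  by apply: eq_bigr => j _; rewrite big_bool addrC.
have Re2 (a b : R) (x y : C) : Re (a%:C * x + b%:C * y) = a * Re x + b * Re y.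
  by rewrite !ReImE; ring.
have Im2 (a b : R) (x y : C) : Im (a%:C * x + b%:C * y) = a * Im x + b * Im y.
  by rewrite !ReImE; ring.
have ReS (F : 'I_n -> C) : Re (\sum_j F j) = \sum_j Re (F j).
  by apply: (big_morph (fun x : C => Re x) ReD).
have ImS (F : 'I_n -> C) : Im (\sum_j F j) = \sum_j Im (F j).
  by apply: (big_morph (fun x : C => Im x) ImD).
apply: complex_eqP.
  rewrite ReS; transitivity (dirR w (fun y => Re (f y)) z) => //.
  rewrite (@dirR_linear _ _ _ z w U nU) => [|y Uy b|b].
  - rewrite bool_sum; apply: eq_bigr => j _; exact/esym/Re2.
  - by case: (dfU y Uy (rbasis b)).
  - by have /contRP[] := cf b.
rewrite ImS; transitivity (dirR w (fun y => Im (f y)) z) => //.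
rewrite (@dirR_linear _ _ _ z w U nU) => [|y Uy b|b].
- rewrite bool_sum; apply: eq_bigr => j _; exact/esym/Im2.
- by case: (dfU y Uy (rbasis b)).
- by have /contRP[] := cf b.
Qed.

End smooth.

(** * Wirtinger operators *)

Section wirtinger.
Context {R : realType} {n : nat}.
Notation C := R[i].
Notation V := 'rV[C]_n.
Implicit Types (f g h : V -> C) (z u v w : V) (U : set V) (s : C).

(** The two values s = - 'i and s = 'i give the derivative d_v of type (1,0) and
    the derivative dbar_v of type (0,1) in the direction of an arbitrary vector v;
    all rules not depending on the type are proved once for every s. *)
Definition wirt s v f z : C := (dir v f z + s * dir ('i *: v) f z) / 2%:R.

Lemma dzE j f z : dz j f z = wirt (- 'i) (e_ j) f z.
Proof. by rewrite /dz /wirt mulNr. Qed.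
Lemma dzbE j f z : dzb j f z = wirt 'i (e_ j) f z.
Proof. by []. Qed.

Lemma mulCii : 'i * 'i = -1 :> C. Proof. by rewrite -expr2 sqrCi. Qed.

Lemma C2_neq0 : 2%:R != 0 :> C. Proof. by rewrite pnatr_eq0. Qed.

Lemma wirt_near s v f g z : (\forall y \near z, f y = g y) -> wirt s v f z = wirt s v g z.
Proof. by move=> fg; rewrite /wirt (dir_near v fg) (dir_near _ fg). Qed.
Lemma wirt_ext s v U f g z : open U -> U z -> (forall y, U y -> f y = g y) ->
  wirt s v f z = wirt s v g z.
Proof. by move=> oU Uz fg; apply: wirt_near; exact: near_open fg. Qed.
Lemma wirt_cst s v c z : wirt s v (fun=> c) z = 0.
Proof. by rewrite /wirt !(is_dir_val (is_dir_cst _ _ _)) mulr0 addr0 mul0r. Qed.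
Lemma wirtD s v f g z : dif f z -> dif g z ->
  wirt s v (fun y => f y + g y) z = wirt s v f z + wirt s v g z.
Proof.
move=> df dg; rewrite /wirt.
rewrite !(is_dir_val (is_dirD (difP _ df) (difP _ dg))).
by rewrite -mulrDl; congr (_ / _); rewrite mulrDr addrACA.
Qed.
Lemma wirtM s v f g z : dif f z -> dif g z ->
  wirt s v (fun y => f y * g y) z = wirt s v f z * g z + f z * wirt s v g z.
Proof.
move=> df dg; rewrite /wirt.
rewrite !(is_dir_val (is_dirM (difP _ df) (difP _ dg))).
move: (dir v f z) (dir v g z) (dir ('i *: v) f z) (dir ('i *: v) g z) (f z) (g z) => a b c d x y.
by ring.
Qed.
Lemma wirtM_vanishing s v f g h z : dif f z -> dif g z -> dif h z -> g z = 0 ->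
  wirt s v (fun y => f y * g y * h y) z = f z * wirt s v g z * h z.
Proof.
move=> df dg dh g0; rewrite (wirtM _ _ (difM df dg) dh) (wirtM _ _ df dg) g0.
by rewrite !mulr0 mul0r add0r addr0.
Qed.
Lemma wirtZ s v c f z : dif f z -> wirt s v (fun y => c * f y) z = c * wirt s v f z.
Proof. by move=> df; rewrite wirtM//; [rewrite wirt_cst mul0r add0r|exact: dif_cst]. Qed.
Lemma wirt_sum s v (I : Type) (r : seq I) (f : I -> V -> C) z : (forall i, dif (f i) z) ->
  wirt s v (fun y => \sum_(i <- r) f i y) z = \sum_(i <- r) wirt s v (f i) z.
Proof.
move=> df; elim: r => [|i r IH].
  by under [X in wirt _ _ X]funext do rewrite big_nil; rewrite wirt_cst big_nil.
under [X in wirt _ _ X]funext do rewrite big_cons.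
by rewrite wirtD ?big_cons ?IH//; exact: dif_sum.
Qed.
Lemma wirtJ s v f z : dif f z -> wirt s v (fun y => (f y)^* ) z = (wirt (s^* ) v f z)^*.
Proof.
move=> df; rewrite /wirt !(is_dir_val (is_dirJ (difP _ df))).
by rewrite rmorphM fmorphV rmorphD rmorphM /= conjCK conjC_nat.
Qed.
Lemma wirt_coord s v j z : wirt s v (fun y => y 0 j) z = (1 + s * 'i) * v 0 j / 2%:R.
Proof. by rewrite /wirt !(is_dir_val (is_dir_coord _ _ _)) mxE; congr (_ / _); rewrite mulrDl mul1r mulrA. Qed.

Lemma smooth_wirt s v U f : open U -> smooth_on U f -> smooth_on U (wirt s v f).
Proof.
move=> oU hf; apply: smoothM => //; last exact: smooth_cst.
apply: smoothD => //; first exact: smooth_dir.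
by apply: smoothM => //; [exact: smooth_cst|exact: smooth_dir].
Qed.

Lemma dir_wirt v f z s u U : open U -> U z -> smooth_on U f ->
  dir v (wirt s u f) z = (dir v (dir u f) z + s * dir v (dir ('i *: u) f) z) / 2%:R.
Proof.
move=> oU Uz hf.
have d1 w := difP v (smooth_dif (smooth_dir w hf) Uz).
rewrite (is_dir_val (is_dirM (is_dirD (d1 u) (is_dirM (is_dir_cst _ s _) (d1 ('i *: u)))) (is_dir_cst _ _ _))).
by rewrite mul0r add0r mulr0 addr0.
Qed.

(** The operators are combinations with constant coefficients of directional
    derivatives, which commute. *)
Lemma wirt_comm s t u v U f z : open U -> U z -> smooth_on U f ->
  wirt s u (wirt t v f) z = wirt t v (wirt s u f) z.
Proof.
move=> oU Uz hf; rewrite {1}/wirt [in RHS]/wirt !(dir_wirt _ _ _ oU Uz hf).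
rewrite (schwarz u v oU hf Uz) (schwarz u ('i *: v) oU hf Uz).
rewrite (schwarz ('i *: u) v oU hf Uz) (schwarz ('i *: u) ('i *: v) oU hf Uz).
move: (dir _ _ _) (dir _ _ _) (dir _ _ _) (dir _ _ _) => a b c d.
by ring.
Qed.

Lemma wirt_split v f z : dir v f z = wirt (- 'i) v f z + wirt 'i v f z.
Proof.
rewrite /wirt; move: (dir _ _ _) (dir _ _ _) => a b; rewrite -mulrDl.
have -> : b + - 'i * a + (b + 'i * a) = b * 2%:R by ring.
by rewrite mulfK// C2_neq0.
Qed.

(** A directional derivative is R-linear in its direction; its (1,0) part is
    complex linear and its (0,1) part is antilinear. *)
Lemma wirt_linear U f z v : open U -> U z -> smooth_on U f ->
  wirt (- 'i) v f z = \sum_j v 0 j * dz j f z /\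
  wirt 'i v f z = \sum_j (v 0 j)^* * dzb j f z.
Proof.
move=> oU Uz hf.
have Ev (x : C) : x = (Re x)%:C + 'i * (Im x)%:C by apply: complex_eqP; rewrite !ReImE; ring.
have EJ (x : C) : x^* = (Re x)%:C - 'i * (Im x)%:C by apply: complex_eqP; rewrite !ReImE; ring.
have Ei (x : C) : (Re ('i * x))%:C = - (Im x)%:C /\ (Im ('i * x))%:C = (Re x)%:C.
  by split; apply: complex_eqP; rewrite !ReImE; ring.
have ii := mulCii.
rewrite /wirt !(dir_linear _ oU hf Uz); split.
  rewrite mulr_sumr -big_split /= mulr_suml; apply: eq_bigr => j _.
  rewrite /dz !mxE [in RHS](Ev (v 0 j)); have [-> ->] := Ei (v 0 j).
  move: (dir (e_ j) f z) (dir ('i *: e_ j) f z) (Re (v 0 j))%:C (Im (v 0 j))%:C => a b c d.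
  rewrite mulrA; congr (_ / _).
  rewrite (_ : (c + _) * _ = c * a + 'i * d * a - 'i * c * b - ('i * 'i) * d * b); last by ring.
  by rewrite ii; ring.
rewrite mulr_sumr -big_split /= mulr_suml; apply: eq_bigr => j _.
rewrite /dzb !mxE [in RHS](EJ (v 0 j)); have [-> ->] := Ei (v 0 j).
move: (dir (e_ j) f z) (dir ('i *: e_ j) f z) (Re (v 0 j))%:C (Im (v 0 j))%:C => a b c d.
rewrite mulrA; congr (_ / _).
rewrite (_ : (c - _) * _ = c * a - 'i * d * a + 'i * c * b - ('i * 'i) * d * b); last by ring.
by rewrite ii; ring.
Qed.

Lemma holo_dir v f z : wirt 'i v f z = 0 -> dir ('i *: v) f z = 'i * dir v f z.
Proof.
rewrite /wirt => /eqP; rewrite mulf_eq0 invr_eq0 (negbTE C2_neq0) orbF.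
move: (dir _ _ _) (dir _ _ _) => a b; rewrite addr_eq0 => /eqP ->.
by rewrite mulrN mulrA mulCii mulN1r opprK.
Qed.

(** A holomorphic T maps the pair of directions v, 'i v to w, 'i w where w is the
    (1,0) derivative of T along v; hence it respects the types of derivatives. *)
Lemma wirt_comp s U f (T : V -> V) z v : open U -> smooth_on U f -> U (T z) ->
  (forall j, dif (fun y => T y 0 j) z) ->
  (forall j, wirt 'i v (fun y => T y 0 j) z = 0) ->
  wirt s v (fun y => f (T y)) z = wirt s (\row_j wirt (- 'i) v (fun y => T y 0 j) z) f (T z).
Proof.
move=> oU hf UT dT hT.
rewrite {1}/wirt !(is_dir_val (chain_rule _ oU hf UT dT)) /wirt.
have -> : \row_j dir ('i *: v) (fun y => T y 0 j) z = 'i *: \row_j dir v (fun y => T y 0 j) z.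
  by apply/rowP => j; rewrite !mxE holo_dir.
have e : \row_j wirt (- 'i) v (fun y => T y 0 j) z = \row_j dir v (fun y => T y 0 j) z.
  by apply/rowP => j; rewrite !mxE wirt_split hT addr0.
by rewrite -e.
Qed.

Lemma dif_comp U f (T : V -> V) z : open U -> smooth_on U f -> U (T z) ->
  (forall j, dif (fun y => T y 0 j) z) -> dif (fun y => f (T y)) z.
Proof. by move=> oU hf UT dT v; exact: is_dir_ex (chain_rule v oU hf UT dT). Qed.

End wirtinger.

#[local] Opaque dir wirt dz dzb.

(** * Laplace operators with variable coefficients *)

Section laplacian.
Context {R : realType} {n : nat}.
Notation C := R[i].
Notation V := 'rV[C]_n.
Implicit Types (f g : V -> C) (z l m k : V) (U : set V) (H : V -> 'M[C]_n).

Lemma dzM j f g z (df : dif f z) (dg : dif g z) :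
  dz j (fun y => f y * g y) z = dz j f z * g z + f z * dz j g z.
Proof. by rewrite !dzE wirtM. Qed.
Lemma dzbM j f g z (df : dif f z) (dg : dif g z) :
  dzb j (fun y => f y * g y) z = dzb j f z * g z + f z * dzb j g z.
Proof. by rewrite !dzbE wirtM. Qed.
Lemma dzD j f g z (df : dif f z) (dg : dif g z) :
  dz j (fun y => f y + g y) z = dz j f z + dz j g z.
Proof. by rewrite !dzE wirtD. Qed.
Lemma dzbD j f g z (df : dif f z) (dg : dif g z) :
  dzb j (fun y => f y + g y) z = dzb j f z + dzb j g z.
Proof. by rewrite !dzbE wirtD. Qed.
Lemma dz_ext j U f g z : open U -> U z -> (forall y, U y -> f y = g y) -> dz j f z = dz j g z.
Proof. by move=> oU Uz fg; rewrite !dzE; exact: wirt_ext fg. Qed.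
Lemma dzb_ext j U f g z : open U -> U z -> (forall y, U y -> f y = g y) -> dzb j f z = dzb j g z.
Proof. by move=> oU Uz fg; rewrite !dzbE; exact: wirt_ext fg. Qed.
Lemma smooth_dz U j f : open U -> smooth_on U f -> smooth_on U (dz j f).
Proof.
move=> oU hf; apply: smooth_ext (smooth_wirt (- 'i) (e_ j) oU hf) => // y _.
by rewrite dzE.
Qed.
Lemma smooth_dzb U j f : open U -> smooth_on U f -> smooth_on U (dzb j f).
Proof. by move=> oU hf; exact: (smooth_wirt 'i (e_ j) oU hf). Qed.
Lemma dz_cst j c z : dz j (fun=> c) z = 0. Proof. by rewrite dzE wirt_cst. Qed.
Lemma dzb_cst j c z : dzb j (fun=> c) z = 0. Proof. by rewrite dzbE wirt_cst. Qed.
Lemma dzZ j c f z : dif f z -> dz j (fun y => c * f y) z = c * dz j f z.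
Proof. by move=> df; rewrite !dzE wirtZ. Qed.
Lemma dzbZ j c f z : dif f z -> dzb j (fun y => c * f y) z = c * dzb j f z.
Proof. by move=> df; rewrite !dzbE wirtZ. Qed.
Lemma dz_sum j (f : 'I_n -> V -> C) z : (forall i, dif (f i) z) ->
  dz j (fun y => \sum_i f i y) z = \sum_i dz j (f i) z.
Proof. by move=> df; rewrite dzE wirt_sum//; apply: eq_bigr => i _; rewrite dzE. Qed.
Lemma dzb_sum j (f : 'I_n -> V -> C) z : (forall i, dif (f i) z) ->
  dzb j (fun y => \sum_i f i y) z = \sum_i dzb j (f i) z.
Proof. by move=> df; rewrite dzbE wirt_sum. Qed.
Lemma dz_dzb i j U f z : open U -> U z -> smooth_on U f ->
  dz i (dzb j f) z = dzb j (dz i f) z.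
Proof.
move=> oU Uz hf; rewrite dzE (wirt_comm _ _ _ _ oU Uz hf); apply: dzb_ext oU Uz _ => y _.
by rewrite dzE.
Qed.

(** The complex Hessian as a sesquilinear form. *)
Lemma wirt2_linear U f z v : open U -> U z -> smooth_on U f ->
  wirt (- 'i) v (wirt 'i v f) z = \sum_k \sum_l v 0 k * ((v 0 l)^* * dz k (dzb l f) z).
Proof.
move=> oU Uz hf.
refine (etrans (proj1 (wirt_linear v oU Uz (smooth_wirt 'i v oU hf))) _).
apply: eq_bigr => k _; rewrite -mulr_sumr; apply: (congr1 ( *%R (v 0 k))).
have db (l : 'I_n) : dif (dzb l f) z by exact: smooth_dif (smooth_dzb l oU hf) Uz.
refine (etrans (dz_ext k oU Uz (fun y Uy => proj2 (wirt_linear v oU Uy hf))) _).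
rewrite [LHS]dz_sum => [|l]; last by apply: difM; [exact: dif_cst|exact: db].
by apply: eq_bigr => l _; rewrite (dzZ k _ (db l)).
Qed.

Definition lin (l y : V) : C := \sum_j l 0 j * y 0 j.
Definition clin (l y : V) : C := (lin l y)^*.

Lemma smooth_lin U l : open U -> smooth_on U (lin l).
Proof.
move=> oU; apply: smooth_sum => // j.
by apply: smoothM => //; [exact: smooth_cst|exact: smooth_coord].
Qed.
Lemma smooth_clin U l : open U -> smooth_on U (clin l).
Proof. by move=> oU; apply: smoothJ => //; exact: smooth_lin. Qed.
Lemma dif_lin l z : dif (lin l) z.
Proof. by apply: (smooth_dif (smooth_lin l openT)). Qed.
Lemma dif_clin l z : dif (clin l) z.
Proof. by apply: (smooth_dif (smooth_clin l openT)). Qed.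

Lemma wirt_lin s v l z : wirt s v (lin l) z = (1 + s * 'i) / 2%:R * \sum_j l 0 j * v 0 j.
Proof.
rewrite wirt_sum => [|j]; last by apply: difM; [exact: dif_cst|exact: dif_coord].
rewrite mulr_sumr; apply: eq_bigr => j _; rewrite wirtZ; last exact: dif_coord.
by rewrite wirt_coord; ring.
Qed.
Lemma sum_e (l : V) j : \sum_k l 0 k * e_ j 0 k = l 0 j.
Proof.
rewrite (bigD1 j) //= mxE !eqxx mulr1 big1 ?addr0// => k kj.
by rewrite mxE (negbTE kj) andbF mulr0.
Qed.
Lemma dz_lin j l z : dz j (lin l) z = l 0 j.
Proof.
rewrite dzE wirt_lin sum_e mulNr mulCii opprK (_ : (1 + 1) / 2%:R = 1) ?mul1r//.
by rewrite -[1 + 1]/(2%:R) mulfV// C2_neq0.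
Qed.
Lemma dzb_lin j l z : dzb j (lin l) z = 0.
Proof. by rewrite dzbE wirt_lin mulCii subrr !mul0r. Qed.
Lemma dz_clin j l z : dz j (clin l) z = 0.
Proof.
rewrite dzE wirtJ; last exact: dif_lin.
by rewrite wirt_lin rmorphN /= conjCi opprK mulCii subrr !mul0r rmorph0.
Qed.
Lemma dzb_clin j l z : dzb j (clin l) z = (l 0 j)^*.
Proof.
rewrite dzbE wirtJ; last exact: dif_lin.
by rewrite conjCi -dzE dz_lin.
Qed.
Lemma lin0 l : lin l 0 = 0.
Proof. by rewrite /lin big1// => j _; rewrite mxE mulr0. Qed.
Lemma clin0 l : clin l 0 = 0.
Proof. by rewrite /clin lin0 rmorph0. Qed.

(** Common form of both Laplacians of the problem: lapl G has H = invmx G and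
    lapl_c has H = 1. *)
Definition hlap H f z : C := \sum_i \sum_j H z i j * dz j (dzb i f) z.

Lemma sum_1M (F : 'I_n -> 'I_n -> C) : \sum_i \sum_j (1%:M : 'M[C]_n) i j * F i j = \sum_i F i i.
Proof.
apply: eq_bigr => i _; rewrite (bigD1 i) //= mxE eqxx mul1r big1 ?addr0// => j ji.
by rewrite mxE eq_sym (negbTE ji) mul0r.
Qed.

Lemma lapl_cE f z : lapl_c f z = hlap (fun=> 1%:M) f z.
Proof. by rewrite /hlap sum_1M. Qed.

Lemma hlap_ext H U f g z : open U -> U z -> (forall y, U y -> f y = g y) -> hlap H f z = hlap H g z.
Proof.
move=> oU Uz fg; rewrite /hlap; apply: eq_bigr => i _; apply: eq_bigr => j _.
by rewrite (dz_ext j oU Uz (fun y Uy => dzb_ext i oU Uy fg)).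
Qed.

Section domain.
Variables (U : set V) (oU : open U).

Lemma hlapM H f g z : U z -> smooth_on U f -> smooth_on U g ->
  hlap H (fun y => f y * g y) z = hlap H f z * g z + f z * hlap H g z +
    \sum_i \sum_j H z i j * (dzb i f z * dz j g z + dz j f z * dzb i g z).
Proof.
move=> Uz hf hg; rewrite /hlap mulr_suml mulr_sumr -!big_split /=.
apply: eq_bigr => i _; rewrite mulr_suml mulr_sumr -!big_split /=; apply: eq_bigr => j _.
have df := smooth_dif hf Uz; have dg := smooth_dif hg Uz.
have dbf := smooth_dif (smooth_dzb i oU hf) Uz; have dbg := smooth_dif (smooth_dzb i oU hg) Uz.
rewrite (dz_ext j oU Uz (fun y Uy => dzbM i (smooth_dif hf Uy) (smooth_dif hg Uy))).
rewrite (dzD j (difM dbf dg) (difM df dbg)) (dzM j dbf dg) (dzM j df dbg).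
move: (dz j (dzb i f) z) (dz j (dzb i g) z) (dz j f z) (dz j g z) (dzb i f z) (dzb i g z)
  (H z i j) (f z) (g z) => a b c d e r h x y.
by clear; ring.
Qed.

Lemma hlapZ H c f z : U z -> smooth_on U f -> hlap H (fun y => c * f y) z = c * hlap H f z.
Proof.
move=> Uz hf; rewrite /hlap mulr_sumr; apply: eq_bigr => i _.
rewrite mulr_sumr; apply: eq_bigr => j _; rewrite [RHS]mulrCA.
rewrite -(dzZ j c (smooth_dif (smooth_dzb i oU hf) Uz)).
by rewrite (dz_ext j oU Uz (fun y Uy => dzbZ i c (smooth_dif hf Uy))).
Qed.

Lemma hlapD H f g z : U z -> smooth_on U f -> smooth_on U g ->
  hlap H (fun y => f y + g y) z = hlap H f z + hlap H g z.
Proof.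
move=> Uz hf hg; rewrite /hlap -big_split; apply: eq_bigr => i _.
rewrite -big_split; apply: eq_bigr => j _ /=; rewrite -mulrDr.
rewrite -(dzD j (smooth_dif (smooth_dzb i oU hf) Uz) (smooth_dif (smooth_dzb i oU hg) Uz)).
by rewrite (dz_ext j oU Uz (fun y Uy => dzbD i (smooth_dif hf Uy) (smooth_dif hg Uy))).
Qed.

Lemma hlap_cst H c z : U z -> hlap H (fun=> c) z = 0.
Proof.
move=> Uz; rewrite /hlap big1// => i _; rewrite big1// => j _.
rewrite (@dz_ext j U _ (fun=> 0)) // ?dz_cst ?mulr0//.
by move=> y _; rewrite dzb_cst.
Qed.

Lemma hlap_const_on H f c z : U z -> (forall y, U y -> f y = c) -> hlap H f z = 0.
Proof. by move=> Uz fc; rewrite (hlap_ext H oU Uz fc) hlap_cst. Qed.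

(** Every term of the product rule except one contains dbar f, d g or a mixed
    second derivative of f or of g. All the test functions have this form. *)
Lemma hlap_hol_antihol H f g z : U z -> smooth_on U f -> smooth_on U g ->
  (forall i y, U y -> dzb i f y = 0) -> (forall j y, U y -> dz j g y = 0) ->
  hlap H (fun y => f y * g y) z = \sum_i \sum_j H z i j * (dz j f z * dzb i g z).
Proof.
move=> Uz hf hg f0 g0; rewrite hlapM//.
have -> : hlap H f z = 0.
  rewrite /hlap big1// => i _; rewrite big1// => j _.
  by rewrite (dz_ext j oU Uz (f0 i)) dz_cst mulr0.
have -> : hlap H g z = 0.
  rewrite /hlap big1// => i _; rewrite big1// => j _.
  by rewrite (dz_dzb _ _ oU Uz hg) (dzb_ext i oU Uz (g0 j)) dzb_cst mulr0.
rewrite mul0r mulr0 !add0r; apply: eq_bigr => i _; apply: eq_bigr => j _.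
by rewrite f0// mul0r add0r.
Qed.

(** The function r(l, m): the inner product of the constant covectors l and m for
    the dual metric H. *)
Definition pairing H l m : V -> C :=
  fun y => \sum_i \sum_j H y i j * (l 0 j * (m 0 i)^* ).

Lemma hlap_lin H l z : U z -> hlap H (lin l) z = 0.
Proof.
move=> Uz; rewrite /hlap big1// => i _; rewrite big1// => j _.
by rewrite (@dz_ext j U _ (fun=> 0)) // ?dz_cst ?mulr0// => y _; rewrite dzb_lin.
Qed.

Lemma hlap_clin H l z : U z -> hlap H (clin l) z = 0.
Proof.
move=> Uz; rewrite /hlap big1// => i _; rewrite big1// => j _.
rewrite (dz_dzb _ _ oU Uz (smooth_clin l oU)).
by rewrite (@dzb_ext i U _ (fun=> 0)) // ?dzb_cst ?mulr0// => y _; rewrite dz_clin.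
Qed.

Lemma hlap_lin2 H l m z : U z -> hlap H (fun y => lin l y * clin m y) z = pairing H l m z.
Proof.
move=> Uz; rewrite hlap_hol_antihol//.
- by apply: eq_bigr => i _; apply: eq_bigr => j _; rewrite dz_lin dzb_clin.
- exact: smooth_lin.
- exact: smooth_clin.
- by move=> i y _; rewrite dzb_lin.
- by move=> i y _; rewrite dz_clin.
Qed.

Lemma pairing_lin H l m k c d z : pairing H l m z * c + d * pairing H k m z =
  \sum_i \sum_j H z i j * ((l 0 j * c + d * k 0 j) * (m 0 i)^* ).
Proof.
rewrite /pairing mulr_suml mulr_sumr -big_split; apply: eq_bigr => i _.
rewrite mulr_suml mulr_sumr -big_split; apply: eq_bigr => j _ /=; ring.
Qed.

Lemma pairing_clin H l m k c d z : pairing H l m z * c + d * pairing H l k z =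
  \sum_i \sum_j H z i j * (l 0 j * ((m 0 i)^* * c + d * (k 0 i)^* )).
Proof.
rewrite /pairing mulr_suml mulr_sumr -big_split; apply: eq_bigr => i _.
rewrite mulr_suml mulr_sumr -big_split; apply: eq_bigr => j _ /=; ring.
Qed.

Lemma hlap_lin3 H l m k z : U z ->
  hlap H (fun y => (lin l y * lin m y) * clin k y) z =
  pairing H l k z * lin m z + lin l z * pairing H m k z.
Proof.
move=> Uz; rewrite (@hlap_hol_antihol H (fun y => lin l y * lin m y) (clin k))//.
- rewrite pairing_lin; apply: eq_bigr => i _; apply: eq_bigr => j _.
  by rewrite dzM ?dz_lin ?dzb_clin//; exact: dif_lin.
- by apply: smoothM => //; exact: smooth_lin.
- exact: smooth_clin.
- by move=> i y _; rewrite dzbM ?dzb_lin ?mul0r ?mulr0 ?addr0//; exact: dif_lin.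
- by move=> i y _; rewrite dz_clin.
Qed.

Lemma hlap_clin3 H l m k z : U z ->
  hlap H (fun y => lin l y * (clin m y * clin k y)) z =
  pairing H l m z * clin k z + clin m z * pairing H l k z.
Proof.
move=> Uz; rewrite (@hlap_hol_antihol H (lin l) (fun y => clin m y * clin k y))//.
- rewrite pairing_clin; apply: eq_bigr => i _; apply: eq_bigr => j _.
  by rewrite dzbM ?dz_lin ?dzb_clin//; exact: dif_clin.
- exact: smooth_lin.
- by apply: smoothM => //; exact: smooth_clin.
- by move=> i y _; rewrite dzb_lin.
- by move=> i y _; rewrite dzM ?dz_clin ?mul0r ?mulr0 ?addr0//; exact: dif_clin.
Qed.

Lemma hlap_lin4 H l z : U z ->
  hlap H (fun y => (lin l y * lin l y) * (clin l y * clin l y)) z =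
  4%:R * (lin l z * clin l z * pairing H l l z).
Proof.
move=> Uz; rewrite (@hlap_hol_antihol H (fun y => lin l y * lin l y) (fun y => clin l y * clin l y))//.
- rewrite /pairing !mulr_sumr; apply: eq_bigr => i _; rewrite !mulr_sumr; apply: eq_bigr => j _.
  rewrite (dzM j (dif_lin l z) (dif_lin l z)) (dzbM i (dif_clin l z) (dif_clin l z)).
  rewrite dz_lin dzb_clin.
  by move: (lin l z) (clin l z) (l 0 j) ((l 0 i)^* ) (H z i j) => a b c d e; clear; ring.
- by apply: smoothM => //; exact: smooth_lin.
- by apply: smoothM => //; exact: smooth_clin.
- by move=> i y _; rewrite dzbM ?dzb_lin ?mul0r ?mulr0 ?addr0//; exact: dif_lin.
- by move=> i y _; rewrite dzM ?dz_clin ?mul0r ?mulr0 ?addr0//; exact: dif_clin.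
Qed.

Section at_origin.
Variables (H : V -> 'M[C]_n) (U0 : U 0) (H0 : H 0 = 1%:M)
  (hH : forall i j, smooth_on U (fun y => H y i j)).

Lemma pairing0 l m : pairing H l m 0 = \sum_i l 0 i * (m 0 i)^*.
Proof. by rewrite /pairing H0 sum_1M. Qed.

Lemma smooth_pairing l m : smooth_on U (pairing H l m).
Proof.
apply: smooth_sum => // i; apply: smooth_sum => // j; apply: smoothM => //.
exact: smooth_cst.
Qed.

(** At the origin lin l vanishes and so does its Laplacian, which leaves the
    gradient term. *)
Lemma hlap0_lin g l : smooth_on U g ->
  hlap H (fun y => g y * lin l y) 0 = \sum_i l 0 i * dzb i g 0.
Proof.
move=> hg; rewrite hlapM//; last exact: smooth_lin.
rewrite lin0 hlap_lin// mulr0 mulr0 !add0r H0 sum_1M; apply: eq_bigr => i _.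
by rewrite dz_lin dzb_lin mulr0 addr0 mulrC.
Qed.

Lemma hlap0_clin g l : smooth_on U g ->
  hlap H (fun y => g y * clin l y) 0 = \sum_i (l 0 i)^* * dz i g 0.
Proof.
move=> hg; rewrite hlapM//; last exact: smooth_clin.
rewrite clin0 hlap_clin// mulr0 mulr0 !add0r H0 sum_1M; apply: eq_bigr => i _.
by rewrite dz_clin dzb_clin mulr0 add0r mulrC.
Qed.

End at_origin.
End domain.
End laplacian.

#[local] Opaque dir wirt dz dzb lapl_c.

(** * Iterated Laplacians of the test functions at the origin *)

Section delta.
Context {R : realType} {n : nat}.
Notation C := R[i].
Notation V := 'rV[C]_n.
Implicit Types (f g : V -> C) (z l m k v w : V).
Variables (U : set V) (oU : open U) (U0 : U 0).

Lemma poly_lapl_cE (p : {poly R}) f z (k : nat) : p \is monic -> size p = k.+1 ->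
  poly_lapl_c p f z = \sum_(j < k) (p`_j)%:C * iter j lapl_c f z + iter k lapl_c f z.
Proof.
move=> /monicP pm sp; rewrite /poly_lapl_c sp big_ord_recr /=; congr (_ + _).
have -> : p`_k = 1 by rewrite -pm lead_coefE sp.
by rewrite rmorph1 mul1r.
Qed.

(** On the test functions only the subleading coefficient acts on a nonzero
    iterate of the Euclidean Laplacian. *)
Lemma poly_lapl_c_deg2 (p : {poly R}) f z a : p \is monic -> size p = 3%N ->
  f z = 0 -> lapl_c f z = a -> lapl_c (lapl_c f) z = 0 ->
  poly_lapl_c p f z = (p`_1)%:C * a.
Proof.
move=> pm sp f0 f1 f2; have := poly_lapl_cE f z pm sp.
rewrite !big_ord_recr big_ord0 /= add0r => E.
have comb (x y t c0 c1 s : C) : s = c0 * x + c1 * y + t -> x = 0 -> y = a -> t = 0 -> s = c1 * a.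
  by move=> -> -> -> ->; rewrite mulr0 add0r addr0.
exact: (comb _ _ _ _ _ _ E f0 f1 f2).
Qed.

Lemma poly_lapl_c_deg3 (p : {poly R}) f z a : p \is monic -> size p = 4%N ->
  f z = 0 -> lapl_c f z = 0 -> lapl_c (lapl_c f) z = a -> lapl_c (lapl_c (lapl_c f)) z = 0 ->
  poly_lapl_c p f z = (p`_2)%:C * a.
Proof.
move=> pm sp f0 f1 f2 f3; have := poly_lapl_cE f z pm sp.
rewrite !big_ord_recr big_ord0 /= add0r => E.
have comb (x y t u c0 c1 c2 s : C) : s = c0 * x + c1 * y + c2 * t + u ->
    x = 0 -> y = 0 -> t = a -> u = 0 -> s = c2 * a.
  by move=> -> -> -> -> ->; rewrite !mulr0 !add0r addr0.
exact: (comb _ _ _ _ _ _ _ _ E f0 f1 f2 f3).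
Qed.

Lemma pairing_e (H : V -> 'M[C]_n) (a b : 'I_n) z : pairing H (e_ a) (e_ b) z = H z b a.
Proof.
rewrite /pairing (bigD1 b) //= (bigD1 a) //= !mxE !eqxx /= !mulr1n conjC1 !mulr1.
rewrite !big1 ?addr0// => [i ib|j ja].
  by rewrite big1// => j _; rewrite !mxE (negbTE ib) andbF mulr0n conjC0 !mulr0.
by rewrite !mxE (negbTE ja) andbF mulr0n mul0r mulr0.
Qed.

Lemma sum_eM (F : 'I_n -> C) a : \sum_i (e_ a : V) 0 i * F i = F a.
Proof.
rewrite (bigD1 a) //= mxE !eqxx mulr1n mul1r big1 ?addr0// => i ia.
by rewrite mxE (negbTE ia) andbF mulr0n mul0r.
Qed.

Lemma sum_eJM (F : 'I_n -> C) a : \sum_i ((e_ a : V) 0 i)^* * F i = F a.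
Proof.
rewrite (bigD1 a) //= mxE !eqxx mulr1n conjC1 mul1r big1 ?addr0// => i ia.
by rewrite mxE (negbTE ia) andbF mulr0n conjC0 mul0r.
Qed.

Section general_metric.
Variables (H : V -> 'M[C]_n) (H0 : H 0 = 1%:M)
  (hH : forall i j, smooth_on U (fun y => H y i j)).

Lemma smooth_lin2 l m : smooth_on U (fun y => lin l y * clin m y).
Proof. by apply: smoothM => //; [exact: smooth_lin|exact: smooth_clin]. Qed.

Lemma hlap2_lin3 l m k :
  hlap H (hlap H (fun y => (lin l y * lin m y) * clin k y)) 0 =
  \sum_i m 0 i * dzb i (pairing H l k) 0 + \sum_i l 0 i * dzb i (pairing H m k) 0.
Proof.
have sp a b : smooth_on U (pairing H a b) by exact: smooth_pairing.
rewrite (@hlap_ext _ _ H U _ (fun y => pairing H l k y * lin m y + pairing H m k y * lin l y)) //; last first.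
  by move=> y Uy; rewrite (hlap_lin3 oU H l m k Uy) [X in _ + X = _]mulrC.
rewrite (hlapD oU H U0); try (apply: smoothM => //; exact: smooth_lin).
by rewrite (hlap0_lin oU U0 H0 m (sp l k)) (hlap0_lin oU U0 H0 l (sp m k)).
Qed.

Lemma hlap2_clin3 l m k :
  hlap H (hlap H (fun y => lin l y * (clin m y * clin k y))) 0 =
  \sum_i (k 0 i)^* * dz i (pairing H l m) 0 + \sum_i (m 0 i)^* * dz i (pairing H l k) 0.
Proof.
have sp a b : smooth_on U (pairing H a b) by exact: smooth_pairing.
rewrite (@hlap_ext _ _ H U _ (fun y => pairing H l m y * clin k y + pairing H l k y * clin m y)) //; last first.
  by move=> y Uy; rewrite (hlap_clin3 oU H l m k Uy) [X in _ + X = _]mulrC.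
rewrite (hlapD oU H U0); try (apply: smoothM => //; exact: smooth_clin).
by rewrite (hlap0_clin oU U0 H0 k (sp l m)) (hlap0_clin oU U0 H0 m (sp l k)).
Qed.

Lemma hlap2_lin2 l m : hlap H (hlap H (fun y => lin l y * clin m y)) 0 = hlap H (pairing H l m) 0.
Proof. exact: (hlap_ext H oU U0 (fun y Uy => hlap_lin2 oU H l m Uy)). Qed.

Section quartic.
Variable (l : V).
Let q := pairing H l l.
(* The gradient terms of the product rule for |l|^2 q, without their factors
   lin l and clin l. *)
Let Bf y : C := \sum_i \sum_j H y i j * ((l 0 i)^* * dz j q y).
Let Af y : C := \sum_i \sum_j H y i j * (l 0 j * dzb i q y).
Hypotheses (dH : forall (k i j : 'I_n), dz k (fun y => H y i j) 0 = 0)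
  (dbH : forall (k i j : 'I_n), dzb k (fun y => H y i j) 0 = 0).

Let sq : smooth_on U q. Proof. exact: smooth_pairing. Qed.
Let sBf : smooth_on U Bf.
Proof.
apply: smooth_sum => // i; apply: smooth_sum => // j; apply: smoothM => //.
by apply: smoothM => //; [exact: smooth_cst|exact: smooth_dz].
Qed.
Let sAf : smooth_on U Af.
Proof.
apply: smooth_sum => // i; apply: smooth_sum => // j; apply: smoothM => //.
by apply: smoothM => //; [exact: smooth_cst|exact: smooth_dzb].
Qed.

Let hlap_quartic z : U z -> hlap H (fun y => (lin l y * clin l y) * q y) z =
  (q z * q z + hlap H q z * lin l z * clin l z) + (Bf z * lin l z + Af z * clin l z).
Proof.
move=> Uz; rewrite (hlapM oU H Uz (smooth_lin2 l l) sq) (hlap_lin2 oU H l l Uz); congr (_ + _).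
  by rewrite [X in _ + X = _]mulrC [X in _ + X = _]mulrA.
rewrite /Bf /Af !mulr_suml -big_split; apply: eq_bigr => i _ /=.
rewrite !mulr_suml -big_split; apply: eq_bigr => j _ /=.
rewrite (dzM j (dif_lin l z) (dif_clin l z)) (dzbM i (dif_lin l z) (dif_clin l z)).
rewrite dz_lin dz_clin dzb_lin dzb_clin.
by move: (dz j q z) (dzb i q z) (H z i j) (lin l z) (clin l z) (l 0 j) ((l 0 i)^* ) =>
  a b c d e x y; clear; ring.
Qed.

Let d0 f : smooth_on U f -> dif f 0. Proof. by move=> hf; exact: smooth_dif hf U0. Qed.

(** The derivative has to fall on dz j q, the first derivatives of H being zero. *)
Let dzb_Bf (k : 'I_n) : dzb k Bf 0 = \sum_i (l 0 i)^* * dz i (dzb k q) 0.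
Proof.
have dH0 i j : dif (fun y => H y i j) 0 by exact: d0.
have dt i j : dif (fun y => (l 0 i)^* * dz j q y) 0.
  by apply: difM; [exact: dif_cst|apply: d0; exact: smooth_dz].
rewrite dzb_sum => [|i]; last by apply: dif_sum => j; exact: difM.
rewrite -(@sum_1M R n (fun i j => (l 0 i)^* * dz j (dzb k q) 0)) -H0.
apply: eq_bigr => i _; rewrite dzb_sum => [|j]; last exact: difM.
apply: eq_bigr => j _; rewrite (dzbM k (dH0 i j) (dt i j)) dbH mul0r add0r.
by rewrite (dzbZ k _ (d0 (smooth_dz j oU sq))) (dz_dzb _ _ oU U0 sq).
Qed.

Let dz_Af (k : 'I_n) : dz k Af 0 = \sum_i l 0 i * dz k (dzb i q) 0.
Proof.
have dH0 i j : dif (fun y => H y i j) 0 by exact: d0.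
have dt i j : dif (fun y => l 0 j * dzb i q y) 0.
  by apply: difM; [exact: dif_cst|apply: d0; exact: smooth_dzb].
rewrite dz_sum => [|i]; last by apply: dif_sum => j; exact: difM.
rewrite -(@sum_1M R n (fun i j => l 0 j * dz k (dzb i q) 0)) -H0.
apply: eq_bigr => i _; rewrite dz_sum => [|j]; last exact: difM.
apply: eq_bigr => j _; rewrite (dzM k (dH0 i j) (dt i j)) dH mul0r add0r.
by rewrite (dzZ k _ (d0 (smooth_dzb i oU sq))).
Qed.

Let dz_q (k : 'I_n) : dz k q 0 = 0.
Proof.
have dH0 i j : dif (fun y => H y i j * (l 0 j * (l 0 i)^* )) 0.
  by apply: d0; apply: smoothM => //; exact: smooth_cst.
rewrite dz_sum => [|i]; last by apply: dif_sum => j; exact: dH0.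
rewrite big1// => i _; rewrite dz_sum => [|j]; last exact: dH0.
rewrite big1// => j _; rewrite (dzM k (d0 (hH i j)) (dif_cst _ _)).
by rewrite dH dz_cst mul0r mulr0 addr0.
Qed.

Let dzb_q (k : 'I_n) : dzb k q 0 = 0.
Proof.
have dH0 i j : dif (fun y => H y i j * (l 0 j * (l 0 i)^* )) 0.
  by apply: d0; apply: smoothM => //; exact: smooth_cst.
rewrite dzb_sum => [|i]; last by apply: dif_sum => j; exact: dH0.
rewrite big1// => i _; rewrite dzb_sum => [|j]; last exact: dH0.
rewrite big1// => j _; rewrite (dzbM k (d0 (hH i j)) (dif_cst _ _)).
by rewrite dbH dzb_cst mul0r mulr0 addr0.
Qed.

Lemma smooth_hlap f : smooth_on U f -> smooth_on U (hlap H f).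
Proof.
move=> hf; apply: smooth_sum => // i; apply: smooth_sum => // j; apply: smoothM => //.
by apply: smooth_dz => //; exact: smooth_dzb.
Qed.

(** Apply the Laplacian to each of the four terms of hlap_quartic. Since dq(0) = 0,
    q^2 contributes 2 q L q and |l|^2 L q contributes q L q; each of the two gradient
    terms contributes the contracted complex Hessian of q. *)
Lemma hlap2_quartic : hlap H (hlap H (fun y => (lin l y * clin l y) * q y)) 0 =
  3%:R * (q 0 * hlap H q 0) + 2%:R * \sum_i \sum_j (l 0 i)^* * (l 0 j * dz i (dzb j q) 0).
Proof.
rewrite (hlap_ext H oU U0 hlap_quartic).
have sL := smooth_hlap sq; have sl := smooth_lin l oU; have scl := smooth_clin l oU.
have s1 : smooth_on U (fun y => q y * q y) by exact: smoothM.
have s2 : smooth_on U (fun y => hlap H q y * lin l y) by exact: smoothM.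
have s3 : smooth_on U (fun y => hlap H q y * lin l y * clin l y) by exact: smoothM.
have s4 : smooth_on U (fun y => Bf y * lin l y) by exact: smoothM.
have s5 : smooth_on U (fun y => Af y * clin l y) by exact: smoothM.
rewrite (hlapD oU H U0 (smoothD oU s1 s3) (smoothD oU s4 s5)).
rewrite (hlapD oU H U0 s1 s3) (hlapD oU H U0 s4 s5).
rewrite (hlap0_lin oU U0 H0 l sBf) (hlap0_clin oU U0 H0 l sAf) (hlap0_clin oU U0 H0 l s2).
have dq2 : \sum_i \sum_j H 0 i j * (dzb i q 0 * dz j q 0 + dz j q 0 * dzb i q 0) = 0.
  rewrite big1// => i _; rewrite big1// => j _; by rewrite dz_q dzb_q !mulr0 addr0 mulr0.
rewrite (hlapM oU H U0 sq sq) dq2.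
have -> : \sum_i (l 0 i)^* * dz i (fun y => hlap H q y * lin l y) 0 = q 0 * hlap H q 0.
  rewrite (pairing0 H0 l l : q 0 = _) mulr_suml; apply: eq_bigr => i _.
  rewrite (dzM i (d0 sL) (d0 sl)) dz_lin lin0 mulr0 add0r.
  by move: (hlap H q 0) => a; clear; ring.
have -> : \sum_i (l 0 i)^* * dz i Af 0 = \sum_i \sum_j (l 0 i)^* * (l 0 j * dz i (dzb j q) 0).
  by apply: eq_bigr => i _; rewrite dz_Af mulr_sumr.
have -> : \sum_i l 0 i * dzb i Bf 0 = \sum_i \sum_j (l 0 i)^* * (l 0 j * dz i (dzb j q) 0).
  rewrite exchange_big; apply: eq_bigr => j _; rewrite dzb_Bf mulr_sumr.
  by apply: eq_bigr => i _; rewrite mulrCA.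
by move: (\sum_i _) (hlap H q 0) (q 0) => a b c; clear; ring.
Qed.

End quartic.
End general_metric.
End delta.

(** * Kaehler symmetries of the metric *)

Section kaehler.
Context {R : realType} {n : nat}.
Notation C := R[i].
Notation V := 'rV[C]_n.
Implicit Types (f : V -> C) (z l u v w : V) (U : set V).

Lemma hform_scale_e (G : V -> 'M[C]_n) z (c d : C) a b :
  hform G z (c *: e_ a) (d *: e_ b) = c * d^* * G z a b.
Proof.
rewrite /hform (bigD1 a) //= (bigD1 b) //= !mxE !eqxx /= !mulr1n !mulr1.
rewrite !big1 ?addr0 => [|i ia|j jb].
- by rewrite -mulrA mulrC.
- by rewrite big1// => j _; rewrite !mxE (negbTE ia) andbF mulr0n !mulr0 mul0r.
- by rewrite !mxE (negbTE jb) andbF mulr0n mulr0 conjC0 mulr0.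
Qed.

(** Closedness only gives real equations, for real and imaginary multiples of the
    three vectors. Here x_1, x_2 are the derivatives of G_{bc} along e_a and 'i e_a,
    x_3, x_4 those of G_{ca} along e_b and 'i e_b, and x_5, x_6 those of G_{ab} along
    e_c and 'i e_c. Combining the eight equations eliminates the third pair and identifies
    the (1,0) derivatives of G_{bc} and of the conjugate of G_{ca}, which is G_{ac}. *)
Lemma closed_form_algebra (x1 x2 x3 x4 x5 x6 : C) :
  let closed_at (x y t u v w : C) :=
    Im (y * t^* * u) + Im (t * x^* * v) + Im (x * y^* * w) = 0 in
  closed_at 1 1 1 x1 x3 x5 -> closed_at 'i 'i 1 x2 x4 x5 ->
  closed_at 'i 1 'i x2 x3 x6 -> closed_at 1 'i 'i x1 x4 x6 ->
  closed_at 'i 1 1 x2 x3 x5 -> closed_at 1 'i 1 x1 x4 x5 ->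
  closed_at 1 1 'i x1 x3 x6 -> closed_at 'i 'i 'i x2 x4 x6 ->
  x1 - 'i * x2 = x3^* - 'i * x4^*.
Proof.
case: x1 x2 x3 x4 x5 x6 => [x1 y1] [x2 y2] [x3 y3] [x4 y4] [x5 y5] [x6 y6].
move=> closed_at; rewrite {}/closed_at !ReImE => k1 k2 k3 k4 m1 m2 m3 m4.
apply: complex_eqP; rewrite !ReImE; lra.
Qed.

(** The (2,1) part of d omega = 0. *)
Lemma kaehler_symmetric (G : V -> 'M[C]_n) U z : open U -> U z ->
  (forall i j, smooth_on U (fun y => G y i j)) ->
  (forall y, U y -> forall i j, G y j i = (G y i j)^* ) ->
  (forall u v w, dkform G z u v w = 0) ->
  forall a b c, dz a (fun y => G y b c) z = dz b (fun y => G y a c) z.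
Proof.
move=> oU Uz hG herm closed a b c.
have dG i j : dif (fun y => G y i j) z by exact: smooth_dif (hG i j) Uz.
pose X u i j := dir u (fun y => G y i j) z.
have XJ u i j : X u j i = (X u i j)^*.
  rewrite /X -(is_dir_val (is_dirJ (difP u (dG i j)))).
  by apply: dir_near; apply: (near_open oU Uz) => y Uy; exact: herm.
have dk u c1 c2 i j : dirR u (fun y => kform G y (c1 *: e_ i) (c2 *: e_ j)) z =
    - Im (c1 * c2^* * X u i j).
  rewrite -(dirR_NIm _ _ (dG i j)).
  have -> : (fun y => kform G y (c1 *: e_ i) (c2 *: e_ j)) = (fun y => - Im (c1 * c2^* * G y i j)).
    by apply/funext => y; rewrite /kform hform_scale_e.
  by [].
have key (x y t : C) : Im (y * t^* * X (x *: e_ a) b c) + Im (t * x^* * X (y *: e_ b) c a)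
   + Im (x * y^* * X (t *: e_ c) a b) = 0.
  have := closed (x *: e_ a) (y *: e_ b) (t *: e_ c).
  rewrite /dkform !dk -!opprD => /eqP; rewrite oppr_eq0 => /eqP //.
have k1 := key 1 1 1; have k2 := key 'i 'i 1; have k3 := key 'i 1 'i; have k4 := key 1 'i 'i.
have m1 := key 'i 1 1; have m2 := key 1 'i 1; have m3 := key 1 1 'i; have m4 := key 'i 'i 'i.
rewrite !dzE.
have wirtX u i j : wirt (- 'i) u (fun y => G y i j) z = (X u i j - 'i * X ('i *: u) i j) / 2%:R.
  by rewrite -mulNr.
rewrite !wirtX (XJ _ c a) (XJ _ c a).
have := closed_form_algebra k1 k2 k3 k4 m1 m2 m3 m4.
by rewrite !scale1r => ->.
Qed.

(** The conjugate of kaehler_symmetric, G being Hermitian. *)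
Lemma kaehler_symmetric_bar (G : V -> 'M[C]_n) U z : open U -> U z ->
  (forall i j, smooth_on U (fun y => G y i j)) ->
  (forall y, U y -> forall i j, G y j i = (G y i j)^* ) ->
  (forall u v w, dkform G z u v w = 0) ->
  forall a b c, dzb a (fun y => G y b c) z = dzb c (fun y => G y b a) z.
Proof.
move=> oU Uz hG herm closed a b c.
have conj_dz k i j : dzb k (fun y => G y i j) z = (dz k (fun y => G y j i) z)^*.
  refine (etrans (dzb_ext k oU Uz (fun y Uy => herm y Uy j i)) _).
  by rewrite dzbE wirtJ ?conjCi -?dzE//; exact: smooth_dif (hG j i) Uz.
by rewrite !conj_dz (kaehler_symmetric oU Uz hG herm closed).
Qed.

(** A vector in the left kernel of G would have length zero. *)
Lemma hform_unitmx (G : V -> 'M[C]_n) z :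
  (forall v, v != 0 -> 0 < hform G z v v) -> G z \in unitmx.
Proof.
move=> pos; rewrite unitmxE unitfE; apply/negP => /det0P[v v0 ker_v].
have := pos v v0; suff -> : hform G z v v = 0 by rewrite ltxx.
rewrite /hform exchange_big big1// => j _.
transitivity ((v *m G z) 0 j * (v 0 j)^* ); last by rewrite ker_v mxE mul0r.
by rewrite mxE mulr_suml; apply: eq_bigr => i _ /=; rewrite [v 0 i * _]mulrC.
Qed.
End kaehler.

(** * The metric at the centre of a chart with the Delta-property *)

Lemma quartic_algebra (R : realType) (a b x y : R[i]) :
  4%:R * (3%:R * (y * (b * y)) + 2%:R * x) = a * (4%:R * y * y) ->
  2%:R * x = (a - 3%:R * b) * y ^+ 2.
Proof.
move=> e; have n4 : 4%:R != 0 :> R[i] by rewrite pnatr_eq0.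
apply: (mulfI n4).
transitivity (4%:R * (3%:R * (y * (b * y)) + 2%:R * x) - 4%:R * 3%:R * b * y ^+ 2); first by ring.
by rewrite e; ring.
Qed.

Section delta_origin.
Context {R : realType} {n : nat}.
Notation C := R[i].
Notation V := 'rV[C]_n.
Implicit Types (f g : V -> C) (z l m k v w : V).
Variables (U : set V) (oU : open U) (U0 : U 0) (G : V -> 'M[C]_n).
Hypotheses (hG : forall i j, smooth_on U (fun y => G y i j))
  (uG : forall y, U y -> G y \in unitmx)
  (dzG : forall a b c : 'I_n, dz a (fun y => G y b c) 0 = dz b (fun y => G y a c) 0)
  (dzbG : forall a b c : 'I_n, dzb a (fun y => G y b c) 0 = dzb c (fun y => G y b a) 0).

Let H (y : V) : 'M[C]_n := invmx (G y).
Let sH i j : smooth_on U (fun y => H y i j). Proof. exact: smooth_invmx. Qed.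
Let Hc (y : V) : 'M[C]_n := 1%:M.
Let sHc i j : smooth_on U (fun y => Hc y i j). Proof. exact: smooth_cst. Qed.

Let pairing_c l m z : pairing Hc l m z = \sum_i l 0 i * (m 0 i)^*.
Proof. by rewrite /pairing sum_1M. Qed.

(** Test on z_a conj(z_b): the left-hand side is the entry (b, a) of the inverse
    metric, the right-hand side that of the identity. *)
Lemma metric_at_origin (p : {poly R}) : p \is monic -> size p = 2 ->
  (forall f, smooth_on U f -> lapl G f 0 = poly_lapl_c p f 0) -> G 0 = 1%:M.
Proof.
move=> pm sp hp.
suff H0 : H 0 = 1%:M by rewrite -[G 0]invmxK -/(H 0) H0 invmx1.
apply/matrixP => b a; rewrite -(pairing_e H) -(hlap_lin2 oU H _ _ U0).
transitivity (lapl G (fun y => lin (e_ a) y * clin (e_ b) y) 0); first by [].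
rewrite (hp _ (smooth_lin2 oU _ _)) (poly_lapl_cE _ _ pm sp) big_ord1 /= lin0 mul0r mulr0 add0r.
by rewrite lapl_cE (hlap_lin2 oU Hc _ _ U0) pairing_e.
Qed.

Section normalised.
Hypothesis G0 : G 0 = 1%:M.
Let H0 : H 0 = 1%:M. Proof. by rewrite /H G0 invmx1. Qed.
Let lapl_cH : lapl_c = hlap Hc :> ((V -> C) -> V -> C).
Proof. by apply/funext => f; apply/funext => z; rewrite lapl_cE. Qed.
Let d0 f : smooth_on U f -> dif f 0. Proof. by move=> hf; exact: smooth_dif hf U0. Qed.

Let HG i j y : U y -> \sum_l H y i l * G y l j = (1%:M : 'M[C]_n) i j.
Proof. by move=> Uy; rewrite -(mulVmx (uG Uy)) mxE. Qed.

Lemma sum_M1 (F : 'I_n -> C) j : \sum_l F l * (1%:M : 'M[C]_n) l j = F j.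
Proof.
rewrite (bigD1 j) //= mxE eqxx mulr1 big1 ?addr0// => l lj.
by rewrite mxE (negbTE lj) mulr0.
Qed.
Lemma sum_1Ml (F : 'I_n -> C) i : \sum_l (1%:M : 'M[C]_n) i l * F l = F i.
Proof.
rewrite (bigD1 i) //= mxE eqxx mul1r big1 ?addr0// => l lj.
by rewrite mxE eq_sym (negbTE lj) mul0r.
Qed.

(* The derivative of invmx G * G = 1. *)
Let wirtHG s v i j y : U y -> \sum_l (wirt s v (fun x => H x i l) y * G y l j +
   H y i l * wirt s v (fun x => G x l j) y) = 0.
Proof.
move=> Uy.
have dU f : smooth_on U f -> dif f y by move=> hf; exact: smooth_dif hf Uy.
transitivity (wirt s v (fun x => \sum_l H x i l * G x l j) y); last first.
  by rewrite (wirt_ext s v oU Uy (HG i j)) wirt_cst.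
rewrite wirt_sum => [|l]; last by apply: difM; exact: dU.
by apply: eq_bigr => l _; rewrite (wirtM s v (dU _ (sH i l)) (dU _ (hG l j))).
Qed.

Lemma wirt_invmx0 s v i j : wirt s v (fun y => H y i j) 0 = - wirt s v (fun y => G y i j) 0.
Proof.
have := wirtHG s v i j U0; rewrite big_split /= G0 H0 sum_M1 sum_1Ml => /eqP.
by rewrite addr_eq0 => /eqP.
Qed.

(** Test on z_c conj(z_a) conj(z_b) for d and on z_c z_a conj(z_b) for dbar. The
    polynomial side vanishes, and the two derivatives of the metric on the other side
    are equal by the Kaehler symmetry. *)
Lemma metric_first_order (p : {poly R}) : p \is monic -> size p = 3%N ->
  (forall f, smooth_on U f -> iter 2 (lapl G) f 0 = poly_lapl_c p f 0) ->
  forall a b c : 'I_n, dz a (fun y => G y b c) 0 = 0 /\ dzb a (fun y => G y b c) 0 = 0.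
Proof.
move=> pm sp hp.
have pe (K : V -> 'M[C]_n) a b : pairing K (e_ a) (e_ b) = (fun y => K y b a).
  by apply/funext => y; rewrite pairing_e.
have dzH a b c : dz a (fun y => H y b c) 0 = - dz a (fun y => G y b c) 0.
  by rewrite !dzE wirt_invmx0.
have dzbH a b c : dzb a (fun y => H y b c) 0 = - dzb a (fun y => G y b c) 0.
  by rewrite !dzbE wirt_invmx0.
have half (x : C) : - x + - x = 0 -> x = 0.
  by move/eqP; rewrite -opprD oppr_eq0 -mulr2n mulrn_eq0 /= => /eqP.
move=> a b c; split; apply: half.
  pose f (y : V) : C := lin (e_ c) y * (clin (e_ a) y * clin (e_ b) y).
  have sf : smooth_on U f.
    by apply: smoothM => //; [exact: smooth_lin|apply: smoothM => //; exact: smooth_clin].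
  have := hp f sf; rewrite (poly_lapl_cE _ _ pm sp) big_ord_recr big_ord1 /= lapl_cH.
  have f0 : f 0 = 0 by rewrite /f lin0 mul0r.
  have f1 : hlap Hc f 0 = 0 by rewrite (hlap_clin3 oU Hc _ _ _ U0) !clin0 mulr0 mul0r addr0.
  have LH : lapl G (lapl G f) 0 = _ := hlap2_clin3 oU U0 H0 sH (e_ c) (e_ a) (e_ b).
  have LC : hlap Hc (hlap Hc f) 0 = 0.
    rewrite (hlap2_clin3 oU U0 (erefl : Hc 0 = 1%:M) sHc) (sum_eJM _ b) (sum_eJM _ a) !pe.
    by rewrite dz_cst dz_cst addr0.
  rewrite f0 f1 LH LC !mulr0 !add0r (sum_eJM _ b) (sum_eJM _ a) !pe !dzH => <-.
  by rewrite addrC (dzG b).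
pose f (y : V) : C := (lin (e_ c) y * lin (e_ a) y) * clin (e_ b) y.
have sf : smooth_on U f.
  by apply: smoothM => //; [apply: smoothM => //; exact: smooth_lin|exact: smooth_clin].
have := hp f sf; rewrite (poly_lapl_cE _ _ pm sp) big_ord_recr big_ord1 /= lapl_cH.
have f0 : f 0 = 0 by rewrite /f lin0 !mul0r.
have f1 : hlap Hc f 0 = 0 by rewrite (hlap_lin3 oU Hc _ _ _ U0) !lin0 mulr0 mul0r addr0.
have LH : lapl G (lapl G f) 0 = _ := hlap2_lin3 oU U0 H0 sH (e_ c) (e_ a) (e_ b).
have LC : hlap Hc (hlap Hc f) 0 = 0.
  rewrite (hlap2_lin3 oU U0 (erefl : Hc 0 = 1%:M) sHc) (sum_eM _ a) (sum_eM _ c) !pe.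
  by rewrite dzb_cst dzb_cst addr0.
rewrite f0 f1 LH LC !mulr0 !add0r (sum_eM _ a) (sum_eM _ c) !pe !dzbH => <-.
by rewrite (dzbG c).
Qed.

Section flat.
Hypotheses (dG : forall a b c : 'I_n, dz a (fun y => G y b c) 0 = 0)
  (dbG : forall a b c : 'I_n, dzb a (fun y => G y b c) 0 = 0).

Let dH a b c : dz a (fun y => H y b c) 0 = 0.
Proof. by rewrite dzE wirt_invmx0 -dzE dG oppr0. Qed.
Let dbH a b c : dzb a (fun y => H y b c) 0 = 0.
Proof. by rewrite dzbE wirt_invmx0 -dzbE dbG oppr0. Qed.

Lemma wirt_flat v i j : wirt (- 'i) v (fun y => G y i j) 0 = 0 /\ wirt 'i v (fun y => G y i j) 0 = 0.
Proof.
have [-> ->] := wirt_linear v oU U0 (hG i j).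
by split; rewrite big1// => k _; rewrite ?dG ?dbG mulr0.
Qed.

(** Differentiating invmx G * G = 1 twice, the products of first derivatives
    disappear. *)
Lemma wirt2_invmx0 v i j : wirt (- 'i) v (wirt 'i v (fun y => H y i j)) 0 =
  - wirt (- 'i) v (wirt 'i v (fun y => G y i j)) 0.
Proof.
have e := wirt_ext (- 'i) v oU U0 (fun y Uy => wirtHG 'i v i j Uy).
rewrite wirt_cst in e.
have sw (K : V -> 'M[C]_n) (a b : 'I_n) : (forall a' b' : 'I_n, smooth_on U (fun y => K y a' b')) ->
    dif (wirt 'i v (fun y => K y a b)) 0 by move=> sK; apply: d0; exact: smooth_wirt.
have d1 (l : 'I_n) : dif (fun y => wirt 'i v (fun x => H x i l) y * G y l j) 0.
  by apply: difM; [exact: sw|exact: d0].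
have d2 (l : 'I_n) : dif (fun y => H y i l * wirt 'i v (fun x => G x l j) y) 0.
  by apply: difM; [exact: d0|exact: sw].
move: e; rewrite wirt_sum => [|l]; last exact: difD.
rewrite (eq_bigr (fun l : 'I_n => wirt (- 'i) v (wirt 'i v (fun y => H y i l)) 0 * (1%:M : 'M[C]_n) l j +
   (1%:M : 'M[C]_n) i l * wirt (- 'i) v (wirt 'i v (fun y => G y l j)) 0)); last first.
  move=> l _; rewrite (wirtD _ _ (d1 l) (d2 l)).
  rewrite (wirtM _ _ (sw H i l sH) (d0 (hG l j))) (wirtM _ _ (d0 (sH i l)) (sw G l j hG)).
  by have [-> ->] := wirt_flat v l j; rewrite !mulr0 addr0 add0r G0 H0.
by rewrite big_split /= sum_M1 sum_1Ml => /eqP; rewrite addr_eq0 => /eqP.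
Qed.

(** The left-hand side is the curvature tensor at the origin on w and its
    conjugate, as the first derivatives of G vanish there. *)
Lemma curvature_at_origin (p2 p3 : {poly R}) :
  p2 \is monic -> size p2 = 3%N -> p3 \is monic -> size p3 = 4%N ->
  (forall f, smooth_on U f -> iter 2 (lapl G) f 0 = poly_lapl_c p2 f 0) ->
  (forall f, smooth_on U f -> iter 3 (lapl G) f 0 = poly_lapl_c p3 f 0) ->
  forall w, - \sum_i \sum_j wirt (- 'i) w (wirt 'i w (fun y => G y i j)) 0 * w 0 i * (w 0 j)^* =
    ((p3`_2 - 3%:R * p2`_1) / 2%:R)%:C * (\sum_i w 0 i * (w 0 i)^* ) ^+ 2.
Proof.
move=> p2m p2s p3m p3s h2 h3 w.
(* The coefficients of a linear form are covariant and those of w are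
   contravariant, hence the conjugation. *)
pose l : V := \row_j (w 0 j)^*.
pose Q : C := \sum_i w 0 i * (w 0 i)^*.
have ll : \sum_i l 0 i * (l 0 i)^* = Q.
  by apply: eq_bigr => i _; rewrite mxE conjCK mulrC.
pose q : V -> C := pairing H l l.
have sq : smooth_on U q by exact: smooth_pairing.
have q0 : q 0 = Q := etrans (pairing0 H0 l l) ll.
have qc z : pairing Hc l l z = Q by rewrite pairing_c.
(* L q (0) is the Ricci curvature of w; it comes from L^2 |l|^2. *)
have Lq : hlap H q 0 = (p2`_1)%:C * Q.
  pose f (y : V) : C := lin l y * clin l y.
  have f0 : f 0 = 0 by rewrite /f lin0 mul0r.
  have f1 z : U z -> lapl_c f z = Q by move=> Uz; rewrite lapl_cH (hlap_lin2 oU Hc l l Uz).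
  have f2 : lapl_c (lapl_c f) 0 = 0.
    by rewrite lapl_cE; apply: (hlap_const_on oU) U0 f1.
  have e : lapl G (lapl G f) 0 = (p2`_1)%:C * Q :=
    etrans (h2 f (smooth_lin2 oU l l)) (poly_lapl_c_deg2 p2m p2s f0 (f1 0 U0) f2).
  by rewrite -e; exact: (esym (hlap2_lin2 oU U0 H l l)).
(* P is the full contraction of the curvature with w; it comes from L^3 |l|^4. *)
pose P : C := \sum_i \sum_j (l 0 i)^* * (l 0 j * dz i (dzb j q) 0).
have eP : 2%:R * P = ((p3`_2)%:C - 3%:R * (p2`_1)%:C) * Q ^+ 2.
  pose f (y : V) : C := (lin l y * lin l y) * (clin l y * clin l y).
  have sf : smooth_on U f.
    by apply: smoothM => //; apply: smoothM => //; [exact: smooth_lin|exact: smooth_lin|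
      exact: smooth_clin|exact: smooth_clin].
  have c1 z : U z -> hlap Hc f z = (4%:R * Q) * (lin l z * clin l z).
    move=> Uz; rewrite (hlap_lin4 oU Hc l Uz) qc; ring.
  have c2 z : U z -> hlap Hc (hlap Hc f) z = 4%:R * Q * Q.
    move=> Uz; rewrite (hlap_ext Hc oU Uz c1) (hlapZ oU Hc _ Uz (smooth_lin2 oU l l)).
    by rewrite (hlap_lin2 oU Hc l l Uz) qc.
  have f0 : f 0 = 0 by rewrite /f lin0 !mul0r.
  have e1 z : U z -> hlap H f z = 4%:R * ((lin l z * clin l z) * q z).
    by move=> Uz; rewrite (hlap_lin4 oU H l Uz).
  have f1 : lapl_c f 0 = 0 by rewrite lapl_cE (c1 0 U0) lin0 mul0r mulr0.
  have f2 : lapl_c (lapl_c f) 0 = 4%:R * Q * Q by rewrite lapl_cH (c2 0 U0).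
  have f3 : lapl_c (lapl_c (lapl_c f)) 0 = 0.
    by rewrite lapl_cH; exact: (hlap_const_on oU Hc U0 c2).
  have e : lapl G (lapl G (lapl G f)) 0 = (p3`_2)%:C * (4%:R * Q * Q) :=
    etrans (h3 f sf) (poly_lapl_c_deg3 p3m p3s f0 f1 f2 f3).
  have s1 : smooth_on U (fun z => (lin l z * clin l z) * q z).
    by apply: smoothM => //; exact: smooth_lin2.
  have e2 z : U z -> hlap H (hlap H f) z = 4%:R * hlap H (fun z => (lin l z * clin l z) * q z) z.
    by move=> Uz; rewrite (hlap_ext H oU Uz e1) (hlapZ oU H _ Uz s1).
  have e3 : hlap H (hlap H (hlap H f)) 0 =
      4%:R * (3%:R * (Q * ((p2`_1)%:C * Q)) + 2%:R * P).
    rewrite (hlap_ext H oU U0 e2) (hlapZ oU H _ U0 (smooth_hlap oU sH s1)).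
    by rewrite (hlap2_quartic oU U0 H0 sH l dH dbH) -/q Lq q0.
  have {}e : 4%:R * (3%:R * (Q * ((p2`_1)%:C * Q)) + 2%:R * P) = (p3`_2)%:C * (4%:R * Q * Q).
    by rewrite -e3; exact: e.
  clear e3.
  exact: quartic_algebra e.
have -> : - \sum_i \sum_j wirt (- 'i) w (wirt 'i w (fun y => G y i j)) 0 * w 0 i * (w 0 j)^* = P.
  have eq : P = wirt (- 'i) w (wirt 'i w q) 0.
    refine (etrans _ (esym (wirt2_linear w oU U0 sq))).
    by apply: eq_bigr => i _; apply: eq_bigr => j _; rewrite !mxE conjCK.
  have sw i j : smooth_on U (wirt 'i w (fun y => H y i j)) by exact: smooth_wirt.
  have dHy i j y : U y -> dif (fun y => H y i j) y by move=> Uy; exact: smooth_dif (sH i j) Uy.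
  have eq1 y : U y -> wirt 'i w q y = \sum_i \sum_j (l 0 j * (l 0 i)^* ) * wirt 'i w (fun y => H y i j) y.
    move=> Uy; have dt i j : dif (fun y => H y i j * (l 0 j * (l 0 i)^* )) y.
      by apply: difM; [exact: dHy|exact: dif_cst].
    rewrite wirt_sum => [|i]; last by apply: dif_sum => j; exact: dt.
    apply: eq_bigr => i _; rewrite wirt_sum => [|j]; last exact: dt.
    apply: eq_bigr => j _; rewrite (wirtM _ _ (dHy i j y Uy) (dif_cst _ _)) wirt_cst mulr0 addr0.
    by rewrite mulrC.
  refine (etrans _ (esym (etrans eq (wirt_ext (- 'i) w oU U0 eq1)))).
  have dt i j : dif (fun y => l 0 j * (l 0 i)^* * wirt 'i w (fun y => H y i j) y) 0.
    by apply: difM; [exact: dif_cst|apply: d0].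
  rewrite [RHS]wirt_sum => [|i]; last by apply: dif_sum => j; exact: dt.
  rewrite -sumrN; apply: eq_bigr => i _; rewrite [RHS]wirt_sum => [|j]; last exact: dt.
  rewrite -sumrN; apply: eq_bigr => j _.
  rewrite (wirtZ _ _ _ (d0 (sw i j))) wirt2_invmx0 !mxE conjCK mulrN.
  by congr (- _); move: (wirt _ _ _ _) => x; rewrite [_ * x]mulrC -mulrA [w 0 i * _]mulrC.
rewrite rmorphM fmorphV rmorphB rmorphM !rmorph_nat -/Q /=.
apply: (mulfI (@C2_neq0 R)); rewrite eP.
by rewrite [RHS]mulrA [X in _ = X * _]mulrC divfK// C2_neq0.
Qed.

End flat.
End normalised.
End delta_origin.

(** * Contraction of four-index arrays *)

Section contraction.
Context {K : comNzRingType} {n : nat}.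
Implicit Types (F : 'I_n -> 'I_n -> 'I_n -> 'I_n -> K) (u w : 'I_n -> K).

Definition contract4 F u w : K :=
  \sum_i \sum_j \sum_k \sum_l F i j k l * u i * w j * u k * w l.

Lemma contract4D F F' u w :
  contract4 (fun i j k l => F i j k l + F' i j k l) u w = contract4 F u w + contract4 F' u w.
Proof.
rewrite /contract4 -big_split; apply: eq_bigr => i _ /=; rewrite -big_split.
apply: eq_bigr => j _ /=; rewrite -big_split; apply: eq_bigr => k _ /=.
by rewrite -big_split; apply: eq_bigr => l _ /=; rewrite !mulrDl.
Qed.

Lemma contract4_sum (F : 'I_n -> 'I_n -> 'I_n -> 'I_n -> 'I_n -> K) u w :
  contract4 (fun i j k l => \sum_p F p i j k l) u w = \sum_p contract4 (F p) u w.
Proof.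
rewrite /contract4 [RHS]exchange_big; apply: eq_bigr => i _ /=.
rewrite [RHS]exchange_big; apply: eq_bigr => j _ /=.
rewrite [RHS]exchange_big; apply: eq_bigr => k _ /=.
by rewrite [RHS]exchange_big; apply: eq_bigr => l _ /=; rewrite !mulr_suml.
Qed.

Lemma sum4_exchange F :
  \sum_i \sum_j \sum_k \sum_l F i j k l = \sum_k \sum_l \sum_i \sum_j F i j k l.
Proof.
transitivity (\sum_i \sum_k \sum_j \sum_l F i j k l).
  by apply: eq_bigr => i _; rewrite exchange_big.
rewrite exchange_big; apply: eq_bigr => k _ /=.
transitivity (\sum_i \sum_l \sum_j F i j k l); last by rewrite exchange_big.
by apply: eq_bigr => i _; rewrite exchange_big.
Qed.

Lemma contract4_sep m (a b : 'I_n -> 'I_n -> K) u w :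
  contract4 (fun i j k l => m * a i k * b j l) u w =
  m * (\sum_i u i * \sum_k u k * a i k) * (\sum_j w j * \sum_l w l * b j l).
Proof.
rewrite -mulrA big_distrlr /= mulr_sumr; apply: eq_bigr => i _ /=.
rewrite mulr_sumr; apply: eq_bigr => j _ /=.
rewrite mulrACA big_distrlr /= !mulr_sumr; apply: eq_bigr => k _ /=.
rewrite !mulr_sumr; apply: eq_bigr => l _ /=.
by move: (u i) (w j) (u k) (w l) (a i k) (b j l) => x1 x2 x3 x4 x5 x6; ring.
Qed.

End contraction.

(** * Invariance of the holomorphic sectional curvature *)

Section tensoriality.
Context {R : realType} {n : nat}.
Notation C := R[i].
Notation V := 'rV[C]_n.
Variables (O U : set V) (oO : open O) (oU : open U) (T : V -> V) (z : V) (Oz : O z).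
Hypotheses (hT : holomorphic_on O T) (TU : forall y, O y -> U (T y)) (Tz : T z = 0).
Variables (G G' : V -> 'M[C]_n).
Hypotheses (hG : forall i j, smooth_on O (fun y => G y i j))
  (hG' : forall i j, smooth_on U (fun y => G' y i j))
  (G'0 : G' 0 = 1%:M)
  (flat : forall u i j, wirt (- 'i) u (fun y => G' y i j) 0 = 0 /\
                        wirt 'i u (fun y => G' y i j) 0 = 0)
  (tr : forall y, O y -> G y = (Defs.jacobian T y)^T *m G' (T y) *m map_mx (@conjc R) (Defs.jacobian T y))
  (uG : G z \in unitmx).
Variable v : V.

(* In the notation of the introduction, W = d_v T is w, X = d_v w, and
   wz is the value of w at z. *)
Let W (a : 'I_n) (y : V) : C := wirt (- 'i) v (fun x => T x 0 a) y.
Let J (a i : 'I_n) (y : V) : C := dz i (fun x => T x 0 a) y.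
Let X (a : 'I_n) (y : V) : C := wirt (- 'i) v (W a) y.
Let g (a b : 'I_n) (y : V) : C := G' (T y) a b.
Let wz : V := \row_a W a z.

Let sT a : smooth_on O (fun y => T y 0 a). Proof. by have [] := hT a. Qed.
Let sW a : smooth_on O (W a). Proof. exact: smooth_wirt. Qed.
Let sJ a i : smooth_on O (J a i). Proof. exact: smooth_dz. Qed.
Let sX a : smooth_on O (X a). Proof. exact: smooth_wirt. Qed.
Let dO (f : V -> C) y : smooth_on O f -> O y -> dif f y. Proof. by move=> hf Oy; exact: smooth_dif hf Oy. Qed.

Let hol u a y : O y -> wirt 'i u (fun x => T x 0 a) y = 0.
Proof.
move=> Oy; refine (etrans (proj2 (wirt_linear u oO Oy (sT a))) _).
by apply: big1 => j _; have [_ h] := hT a; rewrite h// mulr0.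
Qed.

Let hol_wirt u u' a y : O y -> wirt 'i u (wirt (- 'i) u' (fun x => T x 0 a)) y = 0.
Proof.
move=> Oy; refine (etrans (wirt_comm _ _ _ _ oO Oy (sT a)) _).
exact: etrans (wirt_ext (- 'i) u' oO Oy (hol u a)) (wirt_cst _ _ _ _).
Qed.

Let hol_W u a y : O y -> wirt 'i u (W a) y = 0. Proof. exact: hol_wirt. Qed.
Let hol_J u a i y : O y -> wirt 'i u (J a i) y = 0.
Proof.
move=> Oy; refine (etrans (wirt_ext 'i u oO Oy (fun x _ => dzE i (fun x => T x 0 a) x)) _).
exact: hol_wirt.
Qed.
Let hol_X u a y : O y -> wirt 'i u (X a) y = 0.
Proof.
move=> Oy; refine (etrans (wirt_comm _ _ _ _ oO Oy (sW a)) _).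
exact: etrans (wirt_ext (- 'i) v oO Oy (hol_W u a)) (wirt_cst _ _ _ _).
Qed.

Let antihol (f : V -> C) (u y : V) : dif f y -> wirt 'i u f y = 0 -> wirt (- 'i) u (fun x => (f x)^* ) y = 0.
Proof. by move=> df h; rewrite wirtJ// rmorphN /= conjCi opprK h rmorph0. Qed.

Let wirt_conj (f : V -> C) (u y : V) : dif f y -> wirt 'i u (fun x => (f x)^* ) y = (wirt (- 'i) u f y)^*.
Proof. by move=> df; rewrite wirtJ// conjCi. Qed.

Let WJ a y : O y -> W a y = \sum_i v 0 i * J a i y.
Proof. by move=> Oy; exact: (proj1 (wirt_linear v oO Oy (sT a))). Qed.

Let dif_T a y : O y -> dif (fun x => T x 0 a) y. Proof. by move=> Oy; exact: dO. Qed.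

Let dif_compT (f : V -> C) y : smooth_on U f -> O y -> dif (fun x => f (T x)) y.
Proof. by move=> hf Oy; apply: (dif_comp oU hf (TU Oy)) => a; exact: dif_T. Qed.

Let wirt_compT s (f : V -> C) y : smooth_on U f -> O y ->
  wirt s v (fun x => f (T x)) y = wirt s (\row_a W a y) f (T y).
Proof.
move=> hf Oy; apply: (wirt_comp s oU hf (TU Oy)) => a; [exact: dif_T|exact: hol].
Qed.

Let dif_g a b y : O y -> dif (g a b) y.
Proof. by move=> Oy; exact: (dif_compT (hG' a b) Oy). Qed.

Let g_z a b : g a b z = (1%:M : 'M[C]_n) a b.
Proof. by rewrite /g Tz G'0. Qed.

Let wirt_g_z a b : wirt (- 'i) v (g a b) z = 0 /\ wirt 'i v (g a b) z = 0.
Proof.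
by split; refine (etrans (wirt_compT _ (hG' a b) Oz) _); rewrite Tz; have [] := flat (\row_a0 W a0 z) a b.
Qed.

(** At z the matrix g is the identity and its first derivatives vanish, so g is
    a constant for first-order derivatives. *)
Let wirt_frame_entry s a b (A B : V -> C) : s = - 'i \/ s = 'i -> dif A z -> dif B z ->
  wirt s v (fun y => A y * g a b y * B y) z =
  (1%:M : 'M[C]_n) a b * (wirt s v A z * B z + A z * wirt s v B z).
Proof.
move=> hs dA dB; have gz : wirt s v (g a b) z = 0 by case: hs => ->; case: (wirt_g_z a b).
have dg := dif_g a b Oz.
rewrite (wirtM _ _ (difM dA dg) dB) (wirtM _ _ dA dg) gz g_z mulr0 addr0.
move: (wirt s v A z) (wirt s v B z) (A z) (B z) ((1%:M : 'M[C]_n) a b) => x1 x2 x3 x4 x5.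
by clear; ring.
Qed.

Let sum_1MD (F : 'I_n -> 'I_n -> C) : \sum_a \sum_b (1%:M : 'M[C]_n) a b * F a b = \sum_a F a a.
Proof. exact: sum_1M. Qed.

Let wirt_frame s (A : 'I_n -> V -> C) (B : 'I_n -> V -> C) : s = - 'i \/ s = 'i ->
  (forall a, dif (A a) z) -> (forall b, dif (B b) z) ->
  wirt s v (fun y => \sum_a \sum_b A a y * g a b y * B b y) z =
  \sum_a (wirt s v (A a) z * B a z + A a z * wirt s v (B a) z).
Proof.
move=> hs dA dB.
have dt a b : dif (fun y => A a y * g a b y * B b y) z.
  by apply: difM => //; apply: difM => //; exact: dif_g.
rewrite wirt_sum => [|a]; last by apply: dif_sum => b; exact: dt.
rewrite -(sum_1MD (fun a b => wirt s v (A a) z * B b z + A a z * wirt s v (B b) z)).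
apply: eq_bigr => a _; rewrite wirt_sum => [|b]; last exact: dt.
by apply: eq_bigr => b _; exact: wirt_frame_entry.
Qed.

Let metric_pullback y i j : O y -> G y i j = \sum_a \sum_b J a i y * g a b y * (J b j y)^*.
Proof.
move=> Oy; rewrite (tr Oy) mxE exchange_big; apply: eq_bigr => b _.
rewrite !mxE mulr_suml; apply: eq_bigr => a _; by rewrite !mxE.
Qed.

Let metric_pullback_l y q : O y -> \sum_i v 0 i * G y i q = \sum_a \sum_b W a y * g a b y * (J b q y)^*.
Proof.
move=> Oy.
transitivity (\sum_i \sum_a \sum_b v 0 i * J a i y * g a b y * (J b q y)^* ).
  apply: eq_bigr => i _; rewrite (metric_pullback _ _ Oy) mulr_sumr; apply: eq_bigr => a _.
  by rewrite mulr_sumr; apply: eq_bigr => b _; rewrite !mulrA.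
rewrite exchange_big; apply: eq_bigr => a _; rewrite exchange_big; apply: eq_bigr => b _.
by rewrite (WJ _ Oy) !mulr_suml.
Qed.

Let metric_pullback_r y p : O y -> \sum_j (v 0 j)^* * G y p j = \sum_a \sum_b J a p y * g a b y * (W b y)^*.
Proof.
move=> Oy.
transitivity (\sum_j \sum_a \sum_b J a p y * g a b y * ((v 0 j)^* * (J b j y)^* )).
  apply: eq_bigr => j _; rewrite (metric_pullback _ _ Oy) mulr_sumr; apply: eq_bigr => a _.
  by rewrite mulr_sumr; apply: eq_bigr => b _; rewrite mulrCA.
rewrite exchange_big; apply: eq_bigr => a _; rewrite exchange_big; apply: eq_bigr => b _.
rewrite (WJ _ Oy) -mulr_sumr rmorph_sum; congr (_ * _); apply: eq_bigr => j _.
exact/esym/rmorphM.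
Qed.

Let metric_pullback_lr y : O y -> hform G y v v = \sum_a \sum_b W a y * g a b y * (W b y)^*.
Proof.
move=> Oy; rewrite /hform exchange_big.
transitivity (\sum_j \sum_a \sum_b W a y * g a b y * ((v 0 j)^* * (J b j y)^* )).
  apply: eq_bigr => j _; rewrite -mulr_suml.
  rewrite (eq_bigr (fun i => v 0 i * G y i j)) => [|i _]; last by rewrite mulrC.
  rewrite (metric_pullback_l _ Oy) mulr_suml; apply: eq_bigr => a _; rewrite mulr_suml; apply: eq_bigr => b _.
  by rewrite -mulrA [_^* * _]mulrC.
rewrite exchange_big; apply: eq_bigr => a _; rewrite exchange_big; apply: eq_bigr => b _.
rewrite (WJ b Oy) -mulr_sumr rmorph_sum; congr (_ * _); apply: eq_bigr => j _.
exact/esym/rmorphM.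
Qed.

(* First derivatives at z of the metric contracted with v on one side: on the
   other side only the Jacobian at z is left. *)
Let pullback_dz q : \sum_i v 0 i * wirt (- 'i) v (fun y => G y i q) z = \sum_a X a z * (J a q z)^*.
Proof.
transitivity (wirt (- 'i) v (fun y => \sum_i v 0 i * G y i q) z).
  rewrite wirt_sum => [|i]; last by apply: difM; [exact: dif_cst|exact: dO].
  by apply: eq_bigr => i _; rewrite (wirtZ _ _ _ (dO (hG i q) Oz)).
refine (etrans (wirt_ext (- 'i) v oO Oz (fun y => @metric_pullback_l y q)) _).
have dW a : dif (W a) z by exact: dO.
have dJ b : dif (J b q) z by exact: dO.
rewrite (wirt_frame (or_introl erefl) dW (fun b => difJ (dJ b))).
apply: eq_bigr => a _; rewrite (antihol (dJ a) (hol_J v a q Oz)) mulr0 addr0.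
by [].
Qed.

Let pullback_dzb p : \sum_j (v 0 j)^* * wirt 'i v (fun y => G y p j) z = \sum_a J a p z * (X a z)^*.
Proof.
transitivity (wirt 'i v (fun y => \sum_j (v 0 j)^* * G y p j) z).
  rewrite wirt_sum => [|i]; last by apply: difM; [exact: dif_cst|exact: dO].
  by apply: eq_bigr => i _; rewrite (wirtZ _ _ _ (dO (hG p i) Oz)).
refine (etrans (wirt_ext 'i v oO Oz (fun y => @metric_pullback_r y p)) _).
have dW a : dif (W a) z by exact: dO.
have dJ b : dif (J b p) z by exact: dO.
rewrite (wirt_frame (or_intror erefl) dJ (fun b => difJ (dW b))).
apply: eq_bigr => a _; rewrite (hol_J v a p Oz) mul0r add0r.
by rewrite (wirt_conj v (dW a)).
Qed.

Let S : C := \sum_a \sum_b wirt (- 'i) wz (wirt 'i wz (fun y => G' y a b)) 0 * wz 0 a * (wz 0 b)^*.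

(* The second derivatives of g enter through S; the two holomorphic factors w
   and the metric at z, which is the identity, give the square of X = d_v w. *)
Let pullback_dz_dzb : wirt (- 'i) v (wirt 'i v (fun y => hform G y v v)) z = S + \sum_a X a z * (X a z)^*.
Proof.
pose D a b y : C := \sum_d (W d y)^* * dzb d (fun x => G' x a b) (T y).
have wirtg a b y : O y -> wirt 'i v (g a b) y = D a b y.
  move=> Oy; refine (etrans (wirt_compT 'i (hG' a b) Oy) _).
  refine (etrans (proj2 (wirt_linear _ oU (TU Oy) (hG' a b))) _).
  by apply: eq_bigr => d _; rewrite mxE.
have dW a y : O y -> dif (W a) y by exact: dO.
have dX a y : O y -> dif (X a) y by exact: dO.
have ddb a b d y : O y -> dif (fun x => dzb d (fun x => G' x a b) (T x)) y.
  by move=> Oy; apply: dif_compT Oy; exact: smooth_dzb.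
have dD a b y : O y -> dif (D a b) y.
  by move=> Oy; apply: dif_sum => d; apply: difM; [apply: difJ; exact: dW|exact: ddb].
have first y : O y -> wirt 'i v (fun y => hform G y v v) y =
   \sum_a \sum_b W a y * D a b y * (W b y)^* + \sum_a \sum_b W a y * g a b y * (X b y)^*.
  move=> Oy; refine (etrans (wirt_ext 'i v oO Oy metric_pullback_lr) _).
  have dt a b : dif (fun y => W a y * g a b y * (W b y)^* ) y.
    apply: difM; [apply: difM; [exact: dW|exact: dif_g]|apply: difJ; exact: dW].
  rewrite wirt_sum => [|a]; last by apply: dif_sum => b; exact: dt.
  rewrite -big_split; apply: eq_bigr => a _ /=; rewrite wirt_sum => [|b]; last exact: dt.
  rewrite -big_split; apply: eq_bigr => b _ /=.
  rewrite (wirtM _ _ (difM (dW a y Oy) (dif_g a b Oy)) (difJ (dW b y Oy))).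
  rewrite (wirtM _ _ (dW a y Oy) (dif_g a b Oy)) (hol_W v a Oy) mul0r add0r (wirtg a b y Oy).
  by rewrite (wirt_conj v (dW b y Oy)).
refine (etrans (wirt_ext (- 'i) v oO Oz first) _).
have dt1 a b : dif (fun y => W a y * D a b y * (W b y)^* ) z.
  by apply: difM; [apply: difM; [exact: dW|exact: dD]|apply: difJ; exact: dW].
have dt2 a b : dif (fun y => W a y * g a b y * (X b y)^* ) z.
  by apply: difM; [apply: difM; [exact: dW|exact: dif_g]|apply: difJ; exact: dX].
rewrite wirtD; [|by apply: dif_sum => a; apply: dif_sum => b; exact: dt1
              |by apply: dif_sum => a; apply: dif_sum => b; exact: dt2].
congr (_ + _); last first.
  rewrite (wirt_frame (or_introl erefl) (fun a => dW a z Oz) (fun b => difJ (dX b z Oz))).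
  by apply: eq_bigr => a _; rewrite (antihol (dX a z Oz) (hol_X v a Oz)) mulr0 addr0.
rewrite wirt_sum => [|a]; last by apply: dif_sum => b; exact: dt1.
apply: eq_bigr => a _; rewrite wirt_sum => [|b]; last exact: dt1.
apply: eq_bigr => b _.
have Dz : D a b z = 0.
  by rewrite -(wirtg a b z Oz); case: (wirt_g_z a b).
have wirtD_z : wirt (- 'i) v (D a b) z = wirt (- 'i) wz (wirt 'i wz (fun y => G' y a b)) 0.
  have U0 : U 0 by rewrite -Tz; exact: TU.
  have dC d : dif (dzb d (fun x => G' x a b)) 0 by exact: smooth_dif (smooth_dzb d oU (hG' a b)) U0.
  refine (etrans _ (esym (wirt_ext (- 'i) wz oU U0 (fun y Uy => proj2 (wirt_linear wz oU Uy (hG' a b)))))).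
  have dt d : dif (fun y => (W d y)^* * dzb d (fun x => G' x a b) (T y)) z.
    by apply: difM; [apply: difJ; exact: dW|exact: ddb].
  have dt' d : dif (fun y => (wz 0 d)^* * dzb d (fun x => G' x a b) y) 0.
    by apply: difM; [exact: dif_cst|exact: dC].
  rewrite [LHS]wirt_sum => [|d]; last exact: dt.
  rewrite [RHS]wirt_sum => [|d]; last exact: dt'.
  apply: eq_bigr => d _.
  rewrite (wirtZ _ _ _ (dC d)) (wirtM _ _ (difJ (dW d z Oz)) (ddb a b d z Oz)).
  refine (etrans (congr2 +%R (congr1 ( *%R^~ _) (antihol (dW d z Oz) (hol_W v d Oz)))
    (congr1 ( *%R _) (wirt_compT (- 'i) (smooth_dzb d oU (hG' a b)) Oz))) _).
  by rewrite mul0r add0r Tz [wz 0 d]mxE.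
refine (etrans (wirtM_vanishing _ _ (dW a z Oz) (dD a b z Oz) (difJ (dW b z Oz)) Dz) _).
refine (etrans (congr1 (fun t => W a z * t * (W b z)^* ) wirtD_z) _).
by rewrite [wz 0 a]mxE [wz 0 b]mxE (mulrC (W a z)).
Qed.

Let hform_pullback : hform G z v v = \sum_a wz 0 a * (wz 0 a)^*.
Proof.
rewrite (metric_pullback_lr Oz) -(sum_1MD (fun a b => wz 0 a * (wz 0 b)^* )); apply: eq_bigr => a _; apply: eq_bigr => b _.
by rewrite g_z !mxE [W a z * _]mulrC mulrA.
Qed.

(* As G z = J^T conj(J), the inverse metric of the first chart turns the
   Jacobians of pullback_dz and pullback_dzb into the identity. *)
Let inverse_cancels (x : V) : \sum_p \sum_q invmx (G z) q p *
  (\sum_a x 0 a * (J a q z)^* ) * (\sum_b J b p z * (x 0 b)^* ) = \sum_a x 0 a * (x 0 a)^*.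
Proof.
pose Jz := Defs.jacobian T z; pose Jc := map_mx (@conjc R) Jz; pose xc : 'cV[C]_n := \col_b (x 0 b)^*.
have Gz : G z = Jz^T *m Jc by rewrite (tr Oz) Tz G'0 mulmx1.
have [uJ uJc] : Jz^T \in unitmx /\ Jc \in unitmx by apply/andP; rewrite -unitmx_mul -Gz.
have K : Jc *m invmx (G z) *m Jz^T = 1%:M.
  rewrite Gz.
  have -> : invmx (Jz^T *m Jc) = invmx Jc *m invmx Jz^T.
    apply: (can_inj (mulKmx (_ : Jz^T *m Jc \in unitmx))); first by rewrite -Gz.
    rewrite mulmxV -?Gz// Gz mulmxA -[Jz^T *m Jc *m _]mulmxA mulmxV// mulmx1 mulmxV//.
  by rewrite mulmxA mulmxV// mul1mx mulVmx.
transitivity ((x *m (Jc *m invmx (G z) *m Jz^T) *m xc) 0 0); last first.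
  by rewrite K mulmx1 mxE; apply: eq_bigr => a _; rewrite mxE.
have -> : x *m (Jc *m invmx (G z) *m Jz^T) *m xc = (x *m Jc) *m invmx (G z) *m (Jz^T *m xc).
  by rewrite !mulmxA.
rewrite mxE; apply: eq_bigr => p _.
rewrite [in RHS]mxE mulr_suml; apply: eq_bigr => q _.
rewrite !mxE; congr (_ * _); last by apply: eq_bigr => b _; by rewrite !mxE.
by rewrite mulrC; congr (_ * _); apply: eq_bigr => a _; by rewrite !mxE.
Qed.

Let curv_contraction : \sum_i \sum_j \sum_k \sum_l
     curv G z i j k l * v 0 i * (v 0 j)^* * v 0 k * (v 0 l)^* =
  - wirt (- 'i) v (wirt 'i v (fun y => hform G y v v)) z +
  \sum_p \sum_q invmx (G z) q p *
     (\sum_i v 0 i * wirt (- 'i) v (fun y => G y i q) z) *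
     (\sum_j (v 0 j)^* * wirt 'i v (fun y => G y p j) z).
Proof.
transitivity (contract4 (fun i j k l => - dz k (dzb l (fun y => G y i j)) z +
    \sum_p \sum_q invmx (G z) q p * dz k (fun y => G y i q) z * dzb l (fun y => G y p j) z)
    (fun i => v 0 i) (fun j => (v 0 j)^* )); first by [].
rewrite contract4D; apply: (congr2 +%R).
  have sG i j : smooth_on O (fun y => G y i j * v 0 i * (v 0 j)^* ).
    by apply: smoothM => //; [apply: smoothM => //; exact: smooth_cst|exact: smooth_cst].
  have shf : smooth_on O (fun y => hform G y v v).
    by apply: smooth_sum => // i; apply: smooth_sum => // j.
  have db i j y : O y -> dif (fun y => G y i j) y by exact: dO.
  have e1 l y : O y -> dzb l (fun y => hform G y v v) y =
      \sum_i \sum_j (v 0 i * (v 0 j)^* ) * dzb l (fun y => G y i j) y.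
    move=> Oy; rewrite dzb_sum => [|i]; last by apply: dif_sum => j; exact: dO.
    apply: eq_bigr => i _; rewrite dzb_sum => [|j]; last exact: dO.
    apply: eq_bigr => j _.
    rewrite -(dzbZ l _ (db i j y Oy)); apply: dzb_ext oO Oy _ => x _.
    by rewrite -mulrA mulrC.
  have e2 k l : dz k (dzb l (fun y => hform G y v v)) z =
      \sum_i \sum_j (v 0 i * (v 0 j)^* ) * dz k (dzb l (fun y => G y i j)) z.
    refine (etrans (dz_ext k oO Oz (e1 l)) _).
    have ddb i j : dif (dzb l (fun y => G y i j)) z.
      by exact: smooth_dif (smooth_dzb l oO (hG i j)) Oz.
    have dc i j : dif (fun y => (v 0 i * (v 0 j)^* ) * dzb l (fun y => G y i j) y) z.
      by apply: difM; [exact: dif_cst|exact: ddb].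
    rewrite dz_sum => [|i]; last by apply: dif_sum => j; exact: dc.
    apply: eq_bigr => i _; rewrite dz_sum => [|j]; last exact: dc.
    by apply: eq_bigr => j _; rewrite (dzZ k _ (ddb i j)).
  refine (etrans _ (congr1 (fun t => - t) (esym (wirt2_linear v oO Oz shf)))).
  transitivity (- contract4 (fun i j k l => dz k (dzb l (fun y => G y i j)) z)
      (fun i => v 0 i) (fun j => (v 0 j)^* )).
    rewrite /contract4 -sumrN; apply: eq_bigr => i _; rewrite -sumrN; apply: eq_bigr => j _.
    rewrite -sumrN; apply: eq_bigr => k _; rewrite -sumrN; apply: eq_bigr => l _.
    by rewrite !mulNr.
  apply: (congr1 (fun t => - t)).
  transitivity (\sum_k \sum_l \sum_i \sum_j
     dz k (dzb l (fun y => G y i j)) z * v 0 i * (v 0 j)^* * v 0 k * (v 0 l)^* ).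
    exact: sum4_exchange.
  apply: eq_bigr => k _; apply: eq_bigr => l _; rewrite e2 !mulr_sumr.
  apply: eq_bigr => i _; rewrite !mulr_sumr; apply: eq_bigr => j _.
  by move: (dz k _ z) (v 0 i) ((v 0 j)^* ) (v 0 k) ((v 0 l)^* ) => x1 x2 x3 x4 x5; clear; ring.
rewrite contract4_sum; apply: eq_bigr => p _; rewrite contract4_sum; apply: eq_bigr => q _.
rewrite (contract4_sep _ (fun i k => dz k (fun y => G y i q) z) (fun j l => dzb l (fun y => G y p j) z)).
apply: (congr2 *%R).
  apply: (congr1 ( *%R _)); apply: eq_bigr => i _; apply: (congr1 ( *%R _)).
  exact: esym (proj1 (wirt_linear v oO Oz (hG i q))).
apply: eq_bigr => j _; apply: (congr1 ( *%R _)).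
exact: esym (proj2 (wirt_linear v oO Oz (hG p j))).
Qed.

(** By pullback_dz_dzb the second derivative of the metric contributes - S minus the
    square of X to the curvature on v; by inverse_cancels the quadratic term contributes
    plus the square of X. *)
Lemma hol_sec_curv_pullback (kappa : C) : hform G z v v != 0 ->
  (forall w, - \sum_a \sum_b
      wirt (- 'i) w (wirt 'i w (fun y => G' y a b)) 0 * w 0 a * (w 0 b)^* =
    kappa * (\sum_a w 0 a * (w 0 a)^* ) ^+ 2) ->
  hol_sec_curv G z v = kappa.
Proof.
move=> Q0 /(_ wz); rewrite -/S => hS; rewrite /hol_sec_curv curv_contraction pullback_dz_dzb.
have -> : \sum_p \sum_q invmx (G z) q p *
     (\sum_i v 0 i * wirt (- 'i) v (fun y => G y i q) z) *
     (\sum_j (v 0 j)^* * wirt 'i v (fun y => G y p j) z) = \sum_a X a z * (X a z)^*.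
  pose x : V := \row_a X a z.
  have xE a : x 0 a = X a z by rewrite mxE.
  transitivity (\sum_a x 0 a * (x 0 a)^* ); last by apply: eq_bigr => a _; rewrite xE.
  rewrite -inverse_cancels; apply: eq_bigr => p _; apply: eq_bigr => q _.
  by rewrite pullback_dz pullback_dzb; congr (_ * _ * _); apply: eq_bigr => a _; rewrite xE.
rewrite opprD addrNK hS -hform_pullback mulfK// expf_neq0//.
Qed.

End tensoriality.

(** * Charts and conclusion *)

Section charts.
Context {R : realType} {n : nat}.
Notation C := R[i].
Notation V := 'rV[C]_n.

Lemma coord_pointK (M : topologicalType) (c : chart R M n) y : img c y ->
  Defs.coord c (Defs.point c y) = y.
Proof. by case=> x dx <-; rewrite coordK. Qed.

Lemma dom_point (M : topologicalType) (c : chart R M n) y : img c y -> dom c (Defs.point c y).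
Proof. by case=> x dx <-; rewrite coordK. Qed.

Lemma overlapE (M : topologicalType) (c c' : chart R M n) y :
  overlap c c' y <-> img c y /\ dom c' (Defs.point c y).
Proof.
split; first by case=> x [dx dx'] <-; rewrite coordK//; split=> //; exists x.
by case=> iy dy; exists (Defs.point c y); [split=> //; exact: dom_point|exact: coord_pointK].
Qed.

Lemma open_overlap (M : topologicalType) (c c' : chart R M n) : open (overlap c c').
Proof.
rewrite openE => y /overlapE[iy dy].
have := @point_continuous _ _ _ c; rewrite (continuous_open_subspace _ (@img_open _ _ _ c)).
move=> /(_ y (mem_set iy)) cy.
have near1 : \forall x \near y, img c x by apply: open_nbhs_nbhs; split=> //; exact: img_open.
have near2 : \forall x \near y, dom c' (Defs.point c x).
  by apply: cy; apply: open_nbhs_nbhs; split=> //; exact: dom_open.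
rewrite /interior; near=> x; apply/overlapE; split; [near: x; exact: near1|near: x; exact: near2].
Unshelve. all: by end_near. Qed.

Lemma iter_lapl_ext (U : set V) (G : V -> 'M[C]_n) (f h : V -> C) : open U ->
  (forall y, U y -> f y = h y) -> forall k y, U y -> iter k (lapl G) f y = iter k (lapl G) h y.
Proof.
move=> oU fh; elim=> [|k IH] y Uy; first exact: fh.
exact: (hlap_ext (fun x => invmx (G x)) oU Uy IH).
Qed.

Lemma iter_lapl_c_ext (U : set V) (f h : V -> C) : open U ->
  (forall y, U y -> f y = h y) -> forall k y, U y -> iter k lapl_c f y = iter k lapl_c h y.
Proof.
move=> oU fh; elim=> [|k IH] y Uy; first exact: fh.
rewrite !iterS !lapl_cE; exact: (hlap_ext _ oU Uy IH).
Qed.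

(** Transport f to the manifold along the chart. The function obtained agrees with
    f on the image of the chart only, but this is an open neighbourhood of 0 and the
    operators are local. *)
Lemma centered_chart_delta (X : complexManifold R n) (g : kahlerMetric X) (c : chart R X n) x
    (q : {poly R}) k : centered_at c x ->
  (forall (W : set X) (phi : X -> C), open W -> W x -> smooth_fun W phi ->
     iter k (lapl (metric g c)) (phi \o Defs.point c) 0 = poly_lapl_c q (phi \o Defs.point c) 0) ->
  forall f, smooth_on (img c) f -> iter k (lapl (metric g c)) f 0 = poly_lapl_c q f 0.
Proof.
move=> [ac dx cx] hD f sf.
have oU : open (img c) by exact: img_open.
have U0 : img c 0 by exists x.
pose phi (y : X) := f (Defs.coord c y).
have phiE y : img c y -> (phi \o Defs.point c) y = f y.
  by move=> iy; rewrite /phi /= coord_pointK.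
have sphi : smooth_fun (dom c) phi.
  move=> y dy; exists c; split=> //; rewrite setIid.
  by apply: smooth_ext sf => // t it; rewrite phiE.
have := hD (dom c) phi (@dom_open _ _ _ c) dx sphi.
rewrite (iter_lapl_ext _ oU phiE _ U0) => ->.
by rewrite /poly_lapl_c; apply: eq_bigr => j _; rewrite (iter_lapl_c_ext oU phiE _ U0).
Qed.

End charts.

Theorem theorem1 (R : realType) (n : nat) (X : complexManifold R n)
    (g : kahlerMetric X) (hg : Delta_property g) :
  constant_hol_sec_curv g.
Proof.
have [p [hp hx]] := hg.
exists (((p 3%N)`_2 - 3%:R * (p 2%N)`_1) / 2%:R) => c' ac' z iz v v0.
have [c cc hD] := hx (Defs.point c' z).
have [ac dx cx] := cc.
pose U := img c; pose G := metric g c.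
have oU : open U by exact: img_open.
have U0 : U 0 by exists (Defs.point c' z).
have Gs i j : smooth_on U (fun y => G y i j) by exact: (metric_smooth g ac).
have Gherm y : U y -> forall i j, G y j i = (G y i j)^* by exact: (metric_hermitian g ac).
have Gu y : U y -> G y \in unitmx by move=> Uy; apply: hform_unitmx; exact: (metric_pos g ac Uy).
have closed := metric_closed g ac U0.
have delta k : (0 < k)%N -> forall f, smooth_on U f ->
    iter k (lapl G) f 0 = poly_lapl_c (p k) f 0.
  by move=> k0; apply: (centered_chart_delta cc) => W phi oW Wx sphi; exact: (hD W phi oW Wx sphi k k0).
have [m1 s1] := hp 1%N isT; have [m2 s2] := hp 2%N isT; have [m3 s3] := hp 3%N isT.
have G0 := metric_at_origin oU U0 m1 s1 (delta 1%N isT).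
have first := metric_first_order oU U0 Gs Gu (kaehler_symmetric oU U0 Gs Gherm closed)
  (kaehler_symmetric_bar oU U0 Gs Gherm closed) G0 m2 s2 (delta 2%N isT).
have dG a b e := (first a b e).1; have dbG a b e := (first a b e).2.
have curv0 := curvature_at_origin oU U0 Gs Gu G0 dG dbG m2 s2 m3 s3 (delta 2%N isT) (delta 3%N isT).
have oO := @open_overlap _ _ _ c' c.
have Oz : overlap c' c z by apply/overlapE; split.
have sub : overlap c' c `<=` img c' by move=> y /overlapE[].
have TU y : overlap c' c y -> U (transition c' c y).
  by move=> /overlapE[_ dy]; exists (Defs.point c' y).
have [hT _] := atlas_compatible ac' ac.
have pos := metric_pos g ac' iz.
apply: (hol_sec_curv_pullback oO oU Oz hT TU cx _ Gs G0 (wirt_flat oU U0 Gs dG dbG)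
  (metric_transition g ac' ac)) curv0.
- by move=> i j; apply: smooth_sub sub _; exact: (metric_smooth g ac').
- exact: hform_unitmx.
- by rewrite gt_eqF//; exact: pos.
Qed.
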